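(* Let $\mathbb K$ be $\mathbb R$ or $\mathbb C$, let $G\subseteq GL(n,\mathbb K)$ be a toral group with trivial invariant algebra, i.e. $I(G)=\mathbb K$, and let $f\in\mathcal P(G)$. Then there exist $r\geq 1$ and subspaces $W_1,\ldots,W_r$ of $\mathbb K^n$ with $\mathbb K^n=W_1\oplus\cdots\oplus W_r$ such that, writing $x=(x^{(1)},\ldots,x^{(r)})$ according to this decomposition, the differential equation $\dot x=f(x)$ takes the form \[ \begin{array}{rcl} \dot x^{(1)}&=& A_1x^{(1)}\\ \dot x^{(2)}&=&A_2x^{(2)}+ q_2(x^{(1)})\\ &\vdots& \\ \dot x^{(r)}&=&A_rx^{(r)}+q_r(x^{(1)},\ldots,x^{(r-1)}) \end{array} \] with matrices $A_i$ (of appropriate size) and polynomial maps $q_i$. In particular, every solution of the differential equation is elementary (i.e. its components are elementary functions of $t$).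
   Context: The independent variable $t$ is real. A linear algebraic group is a subgroup of $GL(n,\mathbb K)$ which is also an algebraic subvariety. A connected linear algebraic group $G\subseteq GL(n,\mathbb K)$ is called toral if there exists a semisimple $B\in\mathbb K^{(n,n)}$ (diagonalizable over $\mathbb C$) such that $\{\exp(tB);\ t\in\mathbb R\}$ is Zariski-dense in $G$. $I(G)$ denotes the algebra of all polynomials $\varphi:\mathbb K^n\to\mathbb K$ with $\varphi\circ T^{-1}=\varphi$ for all $T\in G$. $\mathcal P(G)$ denotes the set of all $G$-symmetric polynomial vector fields on $\mathbb K^n$, i.e. polynomial maps $f:\mathbb K^n\to\mathbb K^n$ with $f(Tx)=Tf(x)$ for all $T\in G$ and all $x$. *)

(* Defs.v *)
From mathcomp Require Import all_boot all_order all_algebra complex.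
From mathcomp Require Import all_classical all_reals all_analysis.
(* Not imported: the notations of mpoly clash with those of the analysis
   library. *)
From mathcomp Require mpoly.

Set Implicit Arguments.
Unset Strict Implicit.
Unset Printing Implicit Defensive.

Import Order.TTheory GRing.Theory Num.Theory.
Import numFieldNormedType.Exports.

Local Open Scope classical_set_scope.
Local Open Scope ring_scope.
Local Open Scope complex_scope.

Variant base_field := Reals | Complexes.

Definition field_of (R : realType) (F : base_field) : numFieldType :=
  match F with Reals => R | Complexes => R[i] end.

Definition of_real (R : realType) (F : base_field) : R -> field_of R F :=
  match F with Reals => fun x => x | Complexes => fun x => x%:C end.

Definition to_complex (R : realType) (F : base_field) :
    field_of R F -> field_of R Complexes :=
  match F with Reals => fun x => x%:C | Complexes => fun z => z end.

Section Polynomials.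
Variables (K : numFieldType) (n : nat).

Definition polynomial_fun (phi : 'cV[K]_n -> K) :=
  exists p : mpoly.mpoly n K,
    forall x, phi x = mpoly.meval (fun i => x i 0) p.

Definition polynomial_map (m : nat) (f : 'cV[K]_n -> 'cV[K]_m) :=
  forall i, polynomial_fun (fun x => f x i 0).

End Polynomials.

Section ZariskiTopology.
Variables (K : numFieldType) (n : nat).

(* Entries are numbered by [mxvec], so a polynomial function on matrices is a
   polynomial in n * n variables. *)
Definition mx_eval (p : mpoly.mpoly (n * n) K) (T : 'M[K]_n) : K :=
  mpoly.meval (fun k => mxvec T 0 k) p.

Definition zariski_closed (Z : set 'M[K]_n) :=
  exists S : set (mpoly.mpoly (n * n) K),
    Z = [set T | forall p, S p -> mx_eval p T = 0].

Definition zariski_dense_in (S G : set 'M[K]_n) :=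
  S `<=` G /\ forall Z, zariski_closed Z -> S `<=` Z -> G `<=` Z.

Definition zariski_connected (G : set 'M[K]_n) :=
  G !=set0 /\
  forall Z1 Z2, zariski_closed Z1 -> zariski_closed Z2 ->
    G `<=` Z1 `|` Z2 -> G `&` (Z1 `&` Z2) = set0 -> G `<=` Z1 \/ G `<=` Z2.

(* Membership in GL(n, K) is [T \in unitmx]. *)
Definition is_subgroup_GL (G : set 'M[K]_n) :=
  [/\ G `<=` [set T | T \in unitmx],
      G 1%:M,
      forall S T, G S -> G T -> G (S *m T) &
      forall T, G T -> G (invmx T)].

Definition linear_algebraic_group (G : set 'M[K]_n) :=
  is_subgroup_GL G /\
  exists2 Z, zariski_closed Z & G = Z `&` [set T | T \in unitmx].

End ZariskiTopology.

Section Symmetry.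
Variables (K : numFieldType) (n : nat) (G : set 'M[K]_n).

Definition invariant_algebra : set ('cV[K]_n -> K) :=
  [set phi | polynomial_fun phi /\
             forall T, G T -> forall x, phi (invmx T *m x) = phi x].

Definition symmetric_fields : set ('cV[K]_n -> 'cV[K]_n) :=
  [set f | polynomial_map f /\
           forall T, G T -> forall x, f (T *m x) = T *m f x].

End Symmetry.

Definition expm (K : numFieldType) (n : nat) (M : 'M[K]_n) : 'M[K]_n :=
  lim (series (fun k : nat => (k`!%:R)^-1 *: (M ^+ k)) @ \oo).

Section Toral.
Variables (R : realType) (F : base_field) (n : nat).
Local Notation K := (field_of R F).

Definition semisimple (B : 'M[K]_n) :=
  diagonalizable (map_mx (@to_complex R F) B).

Definition toral (G : set 'M[K]_n) :=
  [/\ linear_algebraic_group G, zariski_connected G &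
      exists2 B : 'M[K]_n, semisimple B &
        zariski_dense_in [set expm (of_real F t *: B) | t in [set: R]] G].

(* The time t is real also when K is the field of complex numbers, hence the
   difference quotient with real increments. *)
Definition is_solution (f : 'cV[K]_n -> 'cV[K]_n) (D : set R)
    (x : R -> 'cV[K]_n) :=
  forall t, D t ->
    (of_real F h)^-1 *: (x (t + h) - x t) @[h --> 0^'] --> f (x t).

End Toral.

Section BlockForm.
Variables (K : numFieldType) (n r : nat) (W : 'I_r -> {vspace 'cV[K]_n}).

Definition direct_decomposition :=
  (\sum_(i < r) W i)%VS = fullv /\ directv (\sum_(i < r) W i)%VS.

Definition component (i : 'I_r) (x : 'cV[K]_n) : 'cV[K]_n :=
  sumv_pi (\sum_(j < r) W j)%VS i x.

(* The tuple (x^(1), ..., x^(i-1)) is identified with the element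
   x^(1) + ... + x^(i-1) of the internal direct sum of the first blocks, and a
   polynomial map on that sum is the restriction of one on K^n.  The first
   equation is linear: its q vanishes. *)
Definition triangular_form (f : 'cV[K]_n -> 'cV[K]_n) :=
  exists (A : forall i, 'End(subvs_of (W i))) (q : 'I_r -> 'cV[K]_n -> 'cV[K]_n),
    [/\ forall i, polynomial_map (q i),
        forall i : 'I_r, i = 0%N :> nat -> q i = cst 0 &
        forall i x, component i (f x) =
          vsval (A i (vsproj (W i) (component i x)))
          + q i (\sum_(j < r | (j < i)%N) component j x)].

End BlockForm.

Section Elementary.
Variable R : realType.
Local Notation C := (field_of R Complexes).

Definition cexp (z : R[i]) : C :=
  (expR (complex.Re z) * cos (complex.Im z))
  +i* (expR (complex.Re z) * sin (complex.Im z)).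

(* Elementary functions in Liouville's sense on an open set D of real
   times: generated from the constants and t by rational operations,
   exponentials, continuous branches of logarithms, and continuous algebraic
   functions (solutions of polynomial equations with elementary coefficients;
   the root is required to be simple, so that it depends analytically on the
   coefficients).  Values are complex, so the trigonometric functions and
   their inverses are included.  Values outside D are irrelevant. *)
Inductive elementary (D : set R) : (R -> C) -> Prop :=
| elem_const (c : C) : elementary D (fun=> c)
| elem_time : elementary D (of_real Complexes)
| elem_add g h : elementary D g -> elementary D h ->
    elementary D (fun t => g t + h t)
| elem_opp g : elementary D g -> elementary D (fun t => - g t)
| elem_mul g h : elementary D g -> elementary D h ->
    elementary D (fun t => g t * h t)
| elem_inv g : elementary D g -> (forall t, D t -> g t != 0) ->
    elementary D (fun t => (g t)^-1)
| elem_exp g : elementary D g -> elementary D (fun t => cexp (g t))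
| elem_log g (h : R -> C) : elementary D g -> (forall t, D t -> h @ t --> h t) ->
    (forall t, D t -> cexp (h t) = g t) -> elementary D h
| elem_alg (d : nat) (a : nat -> R -> C) (h : R -> C) :
    (forall k, elementary D (a k)) ->
    (forall t, D t -> h @ t --> h t) ->
    (forall t, D t -> root (\poly_(k < d) a k t) (h t)) ->
    (forall t, D t -> ~~ root (\poly_(k < d) a k t)^`() (h t)) ->
    elementary D h
| elem_ext g h : elementary D g -> (forall t, D t -> h t = g t) ->
    elementary D h.

(* For real K, a real function is elementary when it is so as a complex
   valued function. *)
Definition elementary_vector (F : base_field) (n : nat) (D : set R)
    (x : R -> 'cV[field_of R F]_n) :=
  forall i, elementary D (fun t => to_complex (x t i 0)).

End Elementary.

(* Main.v *)
(* Diagonalize B over C, with eigenvalues lam_i.  A monomial y^m in the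
   eigencoordinates is multiplied by exp (t <m, lam>) under exp (t B), so the
   triviality of the invariant algebra says that the lam_i satisfy no relation
   sum_i m_i lam_i = 0 with m <> 0 in N^n.  Hence "mu - nu is a nonzero
   combination of the lam_i with coefficients in N" is a strict partial order,
   nu before mu.  By symmetry the j-th component of f only contains monomials
   with <m, lam> = lam_j: either linear ones with the same eigenvalue, or
   products of variables whose eigenvalues all come strictly before lam_j.
   Grouping eigenvalues by their rank in this order gives the triangular form.
   The order is stable under complex conjugation when B is real, so the
   projections onto the groups are then real.  The resulting system is solved
   block by block: each block is a linear system with constant coefficients
   forced by an exponential polynomial. *)

Require Import Defs.
From HB Require Import structures.
From mathcomp Require Import all_boot all_order all_algebra complex.
From mathcomp Require Import all_classical all_reals all_analysis.
From mathcomp Require Import ring.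
From mathcomp Require mpoly.
Import (canonicals, coercions) mpoly.

Set Implicit Arguments.
Unset Strict Implicit.
Unset Printing Implicit Defensive.

Import Order.TTheory GRing.Theory Num.Theory.
Import numFieldNormedType.Exports.

Local Open Scope classical_set_scope.
Local Open Scope ring_scope.
Local Open Scope complex_scope.

(** * Complex-valued functions of a real variable *)

Section ComplexDerivative.
Variable R : realType.
Implicit Types (u v : R -> R[i]) (t : R) (z : R[i]).
Local Notation Re := complex.Re.
Local Notation Im := complex.Im.

(** Taken on real and imaginary parts, so that the real differentiation rules and the real mean
    value theorem apply. *)
Definition cderiv u t z :=
  is_derive t 1 (fun s => Re (u s)) (Re z) /\
  is_derive t 1 (fun s => Im (u s)) (Im z).

Lemma ReD (a b : R[i]) : Re (a + b) = Re a + Re b. Proof. by case: a; case: b. Qed.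
Lemma ImD (a b : R[i]) : Im (a + b) = Im a + Im b. Proof. by case: a; case: b. Qed.
Lemma ReN (a : R[i]) : Re (- a) = - Re a. Proof. by case: a. Qed.
Lemma ImN (a : R[i]) : Im (- a) = - Im a. Proof. by case: a. Qed.
Lemma ReM (a b : R[i]) : Re (a * b) = Re a * Re b - Im a * Im b.
Proof. by case: a; case: b. Qed.
Lemma ImM (a b : R[i]) : Im (a * b) = Re a * Im b + Im a * Re b.
Proof. by case: a; case: b. Qed.

Lemma complex_eqP (a b : R[i]) : Re a = Re b -> Im a = Im b -> a = b.
Proof. by case: a; case: b => /= ? ? ? ? -> ->. Qed.

Lemma cderiv_cst z t : cderiv (fun=> z) t 0.
Proof. by split; exact: is_derive_cst. Qed.

Lemma cderivD u v t du dv :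
  cderiv u t du -> cderiv v t dv -> cderiv (fun s => u s + v s) t (du + dv).
Proof.
move=> [u1 u2] [v1 v2]; split.
  by under eq_fun do rewrite ReD; rewrite ReD; exact: is_deriveD.
by under eq_fun do rewrite ImD; rewrite ImD; exact: is_deriveD.
Qed.

Lemma cderivM u v t du dv :
  cderiv u t du -> cderiv v t dv ->
  cderiv (fun s => u s * v s) t (du * v t + u t * dv).
Proof.
move=> [u1 u2] [v1 v2]; split.
  under eq_fun do rewrite ReM.
  apply: (is_derive_eq (is_deriveB (is_deriveM u1 v1) (is_deriveM u2 v2))).
  by rewrite ReD !ReM /GRing.scale /=; ring.
under eq_fun do rewrite ImM.
apply: (is_derive_eq (is_deriveD (is_deriveM u1 v2) (is_deriveM u2 v1))).
by rewrite ImD !ImM /GRing.scale /=; ring.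
Qed.

Lemma cderivZ z u t du : cderiv u t du -> cderiv (fun s => z * u s) t (z * du).
Proof.
move=> du_; have := cderivM (cderiv_cst z t) du_.
by rewrite mul0r add0r.
Qed.

Lemma cderivN u t du : cderiv u t du -> cderiv (fun s => - u s) t (- du).
Proof.
move=> /(cderivZ (-1)); rewrite mulN1r.
by under eq_fun do rewrite mulN1r.
Qed.

Lemma cderivB u v t du dv :
  cderiv u t du -> cderiv v t dv -> cderiv (fun s => u s - v s) t (du - dv).
Proof. by move=> du_ dv_; exact: cderivD (cderivN dv_). Qed.

Lemma cderiv_sum (I : Type) (r : seq I) (P : pred I) (u : I -> R -> R[i]) t
    (du : I -> R[i]) :
  (forall i, P i -> cderiv (u i) t (du i)) ->
  cderiv (fun s => \sum_(i <- r | P i) u i s) t (\sum_(i <- r | P i) du i).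
Proof.
move=> du_; elim: r => [|i r IH].
  by rewrite big_nil; under eq_fun do rewrite big_nil; exact: cderiv_cst.
rewrite big_cons; under eq_fun do rewrite big_cons.
by case: ifPn => [Pi|//]; apply: cderivD => //; exact: du_.
Qed.

Lemma cderiv_time t : cderiv (fun s => s%:C) t 1.
Proof. by split => /=; [exact: is_derive_id | exact: is_derive_cst]. Qed.

Lemma cderiv_eq u t du dv : cderiv u t du -> du = dv -> cderiv u t dv.
Proof. by move=> ? <-. Qed.

Lemma cderiv_unique u t du dv : cderiv u t du -> cderiv u t dv -> du = dv.
Proof.
move=> [[_ r1] [_ i1]] [[_ r2] [_ i2]].
by apply: complex_eqP; [rewrite -r1 -r2|rewrite -i1 -i2].
Qed.

Lemma cderivX u t du k : cderiv u t du ->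
  cderiv (fun s => u s ^+ k.+1) t (k.+1%:R * u t ^+ k * du).
Proof.
move=> du_; elim: k => [|k IH].
  by rewrite expr0 !mul1r; under eq_fun do rewrite expr1.
under eq_fun do rewrite exprS.
apply: (cderiv_eq (cderivM du_ IH)).
by rewrite [k.+2%:R]mulrSr; rewrite !exprS; ring.
Qed.

Lemma cexpD z w : cexp (z + w) = cexp z * cexp w.
Proof.
apply: complex_eqP; rewrite ?ReM ?ImM /cexp /= ReD ImD expRD ?cosD ?sinD; ring.
Qed.

Lemma cexp0 : cexp (0 : R[i]) = 1.
Proof. by rewrite /cexp /= expR0 cos0 sin0 mulr1 mulr0. Qed.

Lemma cexp_neq0 z : cexp z != 0.
Proof.
apply/eqP => z0; have := cexpD z (- z).
by rewrite subrr cexp0 z0 mul0r => /eqP; rewrite oner_eq0.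
Qed.

Lemma cderiv_cexp z t : cderiv (fun s => cexp (s%:C * z)) t (z * cexp (t%:C * z)).
Proof.
have d1 (a : R) : is_derive t 1 (fun s => s * a) a.
  have := @is_deriveZ _ _ _ id a t 1 1 _; rewrite /GRing.scale/= mulr1.
  by under [fun s => s * a]eq_fun do rewrite mulrC; exact.
have E : is_derive t 1 (fun s => expR (s * Re z)) (Re z * expR (t * Re z)).
  have := @is_derive1_comp _ expR (fun s => s * Re z) t _ _
    (is_derive_expR _) (d1 (Re z)).
  by rewrite mulrC.
have S : is_derive t 1 (fun s => sin (s * Im z)) (Im z * cos (t * Im z)).
  have := @is_derive1_comp _ (@sin R) (fun s => s * Im z) t _ _
    (is_derive_sin _) (d1 (Im z)).
  by rewrite mulrC.
have Co : is_derive t 1 (fun s => cos (s * Im z)) (- (Im z * sin (t * Im z))).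
  have := @is_derive1_comp _ (@cos R) (fun s => s * Im z) t _ _
    (is_derive_cos _) (d1 (Im z)).
  by rewrite mulrC mulrN.
have H s : cexp (s%:C * z) = (expR (s * Re z) * cos (s * Im z))
    +i* (expR (s * Re z) * sin (s * Im z)).
  by rewrite /cexp ReM ImM /= !mul0r subr0 addr0.
split; under eq_fun do rewrite H /=.
  apply: (is_derive_eq (is_deriveM E Co)).
  by rewrite ReM H /= /GRing.scale /=; ring.
apply: (is_derive_eq (is_deriveM E S)).
by rewrite ImM H /= /GRing.scale /=; ring.
Qed.

End ComplexDerivative.

(** * Convergence of the complex exponential series *)

Section ExpSeries.
Variable R : realType.
Implicit Types (u v : R -> R[i]) (t : R) (z w : R[i]).
Local Notation Re := complex.Re.
Local Notation Im := complex.Im.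

Lemma mean_value_bound (f df : R -> R) (M a b : R) : a <= b ->
  (forall x, x \in `[a, b] -> is_derive x 1 f (df x)) ->
  (forall x, x \in `[a, b] -> `|df x| <= M) ->
  `|f b - f a| <= M * (b - a).
Proof.
move=> ab d bd.
have sub x : x \in `]a, b[ -> x \in `[a, b] by exact: subset_itv_oo_cc.
have d' x : x \in `]a, b[ -> is_derive x 1 f (df x) by move=> /sub; exact: d.
have cf : {within `[a, b], continuous f}.
  apply: derivable_within_continuous => x xab.
  by have [] := d x xab.
have [c cab ->] := MVT_segment ab d' cf.
by rewrite normrM ler_pM ?normr_ge0 ?bd// ger0_norm ?subr_ge0.
Qed.

Lemma derive0_itv_const (D : set R) (f : R -> R) (a b : R) : is_interval D ->
  (forall t, D t -> is_derive t 1 f 0) -> D a -> D b -> f a = f b.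
Proof.
move=> iD d; wlog ab : a b / a <= b.
  by move=> H Da Db; have [/H|/ltW/H] := leP a b; [exact|move=> ->].
move=> Da Db; apply/esym/eqP; rewrite -subr_eq0 -normr_le0 -(mul0r (b - a)).
apply: (@mean_value_bound f (cst 0)) => // x; rewrite in_itv/= => xab.
  exact/d/(iD a b).
by rewrite normr0.
Qed.

Lemma cderiv0_itv_const (D : set R) u (a b : R) : is_interval D ->
  (forall t, D t -> cderiv u t 0) -> D a -> D b -> u a = u b.
Proof.
move=> iD d Da Db; apply: complex_eqP.
  by apply: (@derive0_itv_const D (fun s => Re (u s))) => // t /d[].
by apply: (@derive0_itv_const D (fun s => Im (u s))) => // t /d[].
Qed.

Lemma ler_Re_normc z : `|Re z| <= Normc.normc z.
Proof.
by case: z => a b; rewrite /= -sqrtr_sqr ler_sqrt ?lerDl ?addr_ge0 ?sqr_ge0.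
Qed.

Lemma ler_Im_normc z : `|Im z| <= Normc.normc z.
Proof.
by case: z => a b; rewrite /= -sqrtr_sqr ler_sqrt ?lerDr ?addr_ge0 ?sqr_ge0.
Qed.

Lemma normc_ge0 z : 0 <= Normc.normc z.
Proof. by case: z => a b; exact: sqrtr_ge0. Qed.

Lemma normc_cexp z : Normc.normc (cexp z) = expR (Re z).
Proof.
rewrite /cexp/= !exprMn -mulrDr cos2Dsin2 mulr1 sqrtr_sqr ger0_norm// expR_ge0.
Qed.

Lemma normcX z k : Normc.normc (z ^+ k) = Normc.normc z ^+ k.
Proof.
elim: k => [|k IH]; first by rewrite !expr0 Normc.normc1.
by rewrite !exprS Normc.normcM IH.
Qed.

Lemma normc_real (a : R) : Normc.normc a%:C = `|a|.
Proof. by rewrite /= expr0n/= addr0 sqrtr_sqr. Qed.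

Lemma normc_inv_fact k : Normc.normc (k`!%:R^-1 : R[i]) = k`!%:R^-1.
Proof.
rewrite Normc.normcV; congr (_^-1).
by rewrite -(rmorph_nat (real_complex R)) normc_real ger0_norm.
Qed.

Definition exp_partial (N : nat) z : R[i] := \sum_(k < N) k`!%:R^-1 * z ^+ k.

Lemma cderiv_exp_partial N z t :
  cderiv (fun s => exp_partial N.+1 (s%:C * z)) t (z * exp_partial N (t%:C * z)).
Proof.
rewrite /exp_partial; under eq_fun do rewrite big_ord_recl.
rewrite -[X in cderiv _ _ X]add0r; apply: cderivD.
  by under eq_fun do rewrite expr0; exact: cderiv_cst.
rewrite mulr_sumr; apply: cderiv_sum => k _.
have dz : cderiv (fun s => s%:C * z) t z.
  under eq_fun do rewrite mulrC.
  by apply: (cderiv_eq (cderivZ z (cderiv_time t))); rewrite mulr1.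
apply: (cderiv_eq (cderivZ _ (cderivX _ dz))) => /=.
rewrite /bump/= add1n factS natrM invfM.
have : k.+1%:R != 0 :> R[i] by rewrite pnatr_eq0.
have : k`!%:R != 0 :> R[i] by rewrite pnatr_eq0 -lt0n fact_gt0.
by move=> ? ?; field; apply/andP; split.
Qed.

(* The mean value theorem applied to exp (- s z) E_(N+1) (s z) on [0, 1],
   whose derivative telescopes to the last term of the partial sum. *)
Lemma exp_partial_remainder N z :
  let r := cexp (- z) * exp_partial N.+1 z - 1 in
  let M := Normc.normc z * expR (Normc.normc z)
             * (Normc.normc z ^+ N / N`!%:R) in
  `|Re r| <= M /\ `|Im r| <= M.
Proof.
move=> r M.
pose u s := cexp (s%:C * (- z)) * exp_partial N.+1 (s%:C * z).
pose du s := - z * cexp (s%:C * (- z)) * (N`!%:R^-1 * (s%:C * z) ^+ N).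
have d s : cderiv u s (du s).
  apply: (cderiv_eq (cderivM (cderiv_cexp _ s) (cderiv_exp_partial N z s))).
  by rewrite /du /exp_partial big_ord_recr/=; ring.
have b s : s \in `[0, 1] -> Normc.normc (du s) <= M.
  rewrite in_itv/= => /andP[s0 s1].
  rewrite /du !Normc.normcM normcX normc_cexp normc_inv_fact Normc.normcM.
  rewrite normc_real ger0_norm//.
  have nN : Normc.normc (- z) = Normc.normc z.
    by case: (z) => p q /=; rewrite !sqrrN.
  rewrite nN.
  have sz : s * Normc.normc z <= Normc.normc z.
    by rewrite ler_piMl ?normc_ge0.
  rewrite /M ler_pM ?mulr_ge0 ?normc_ge0 ?expR_ge0 ?invr_ge0 ?exprn_ge0
    ?ler0n ?mulr_ge0 ?normc_ge0//.
    rewrite ler_wpM2l ?normc_ge0// ler_expR.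
    apply: (le_trans (ler_norm _)); apply: (le_trans (ler_Re_normc _)).
    by rewrite Normc.normcM normc_real ger0_norm// nN.
  rewrite mulrC ler_wpM2r ?invr_ge0 ?ler0n//.
  by rewrite lerXn2r// nnegrE ?mulr_ge0 ?normc_ge0.
have u1 : u 1 - u 0 = r.
  have p0 : exp_partial N.+1 0 = 1.
    rewrite /exp_partial big_ord_recl/= expr0 fact0 invr1 mul1r big1 ?addr0//.
    by move=> i _; rewrite expr0n/= mulr0.
  by rewrite /u /r !mul1r !mul0r cexp0 p0 mulr1.
split.
  have := @mean_value_bound (fun s => Re (u s)) (fun s => Re (du s)) M 0 1 ler01.
  rewrite subr0 mulr1 -ReN -ReD u1; apply.
    by move=> x _; case: (d x).
  by move=> x /b; apply: le_trans; exact: ler_Re_normc.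
have := @mean_value_bound (fun s => Im (u s)) (fun s => Im (du s)) M 0 1 ler01.
rewrite subr0 mulr1 -ImN -ImD u1; apply.
  by move=> x _; case: (d x).
by move=> x /b; apply: le_trans; exact: ler_Im_normc.
Qed.

(** Convergence by components; [cvg_of_ccvg] converts it into convergence in K. *)
Definition ccvg (a : nat -> R[i]) (l : R[i]) :=
  (fun k => Re (a k)) @ \oo --> Re l /\ (fun k => Im (a k)) @ \oo --> Im l.

Lemma ccvg_cst l : ccvg (fun=> l) l.
Proof. by split; exact: cvg_cst. Qed.

Lemma ccvgD a b l m : ccvg a l -> ccvg b m -> ccvg (fun k => a k + b k) (l + m).
Proof.
move=> [a1 a2] [b1 b2]; split.
  by under eq_fun do rewrite ReD; rewrite ReD; exact: cvgD.
by under eq_fun do rewrite ImD; rewrite ImD; exact: cvgD.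
Qed.

Lemma ccvgM a b l m : ccvg a l -> ccvg b m -> ccvg (fun k => a k * b k) (l * m).
Proof.
move=> [a1 a2] [b1 b2]; split.
  by under eq_fun do rewrite ReM; rewrite ReM; apply: cvgB; exact: cvgM.
by under eq_fun do rewrite ImM; rewrite ImM; apply: cvgD; exact: cvgM.
Qed.

Lemma ccvg_sum (I : Type) (r : seq I) (a : I -> nat -> R[i]) (l : I -> R[i]) :
  (forall i, ccvg (a i) (l i)) ->
  ccvg (fun k => \sum_(i <- r) a i k) (\sum_(i <- r) l i).
Proof.
move=> al; elim: r => [|i r IH].
  by rewrite big_nil; under eq_fun do rewrite big_nil; exact: ccvg_cst.
by rewrite big_cons; under eq_fun do rewrite big_cons; exact: ccvgD.
Qed.

(** The bound of [exp_partial_remainder] is a constant times the general term of the real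
    exponential series, so [cexp (- z) * exp_partial N z] tends to 1; multiplying by [cexp z] gives
    the limit. *)
Lemma exp_partial_cvg z : ccvg (fun N => exp_partial N z) (cexp z).
Proof.
suff [r1 r2] : ccvg (fun N => cexp (- z) * exp_partial N z - 1) 0.
  have /(ccvgM (ccvg_cst (cexp z))) :=
    ccvgD (conj r1 r2 : ccvg _ _) (ccvg_cst 1).
  rewrite add0r mulr1; under eq_fun do
    rewrite subrK mulrA -cexpD subrr cexp0 mul1r.
  exact.
pose M N := Normc.normc z * expR (Normc.normc z)
             * (Normc.normc z ^+ N / N`!%:R).
have M0 : M @ \oo --> 0.
  rewrite -(mulr0 (Normc.normc z * expR (Normc.normc z))).
  apply: cvgM; first exact: cvg_cst.
  by apply: cvg_series_cvg_0; exact: is_cvg_series_exp_coeff.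
have NM0 : (- M) @ \oo --> 0 by rewrite -oppr0; exact: cvgN.
(* The remainder estimate concerns [exp_partial N.+1], hence the shift of the index. *)
split; rewrite -cvg_shiftS.
  apply: (@squeeze_cvgr _ _ _ _ (- M) M) => //.
  near=> N; rewrite -ler_norml.
  by case: (exp_partial_remainder N z).
apply: (@squeeze_cvgr _ _ _ _ (- M) M) => //.
near=> N; rewrite -ler_norml.
by case: (exp_partial_remainder N z).
Unshelve. all: by end_near.
Qed.

End ExpSeries.

(** * The field K inside C *)

Lemma Re_continuous (R : realType) :
  continuous (@complex.Re R : field_of R Complexes -> R).
Proof.
move=> z; apply/(@cvgrPdist_lt _ _ _ _ (nbhs_filter z)) => e e0.
have e0' : (0 : field_of R Complexes) < e%:C by rewrite ltcR.
apply: filterS (@nbhsx_ballx _ (field_of R Complexes) z _ e0') => w.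
rewrite /ball /= => zw; rewrite -ltcR; apply: le_lt_trans zw.
rewrite -ReN -ReD.
exact: normc_ge_Re.
Qed.
Lemma Im_continuous (R : realType) :
  continuous (@complex.Im R : field_of R Complexes -> R).
Proof.
have -> : (@complex.Im R) =
    fun z : field_of R Complexes => complex.Re (z * (0 -i* 1)).
  by apply/funext => -[a b] /=; rewrite mulr0 mulrN mulr1 opprK add0r.
move=> z; apply: continuous_comp; last exact: Re_continuous.
exact: mulrr_continuous.
Qed.
Lemma cvg_mx_entries (K : numFieldType) (m n : nat)
    (M : nat -> 'M[K]_(m, n)) (A : 'M[K]_(m, n)) :
  (forall i j, (fun k => M k i j) @ \oo --> A i j) -> M @ \oo --> A.
Proof.
move=> H; apply/cvg_ballP => e e0.
have : \forall k \near \oo, forall p : 'I_m * 'I_n,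
    ball (A p.1 p.2) e (M k p.1 p.2).
  by apply: filter_forall => -[i j]; exact: (cvg_ball (H i j)).
apply: filterS => k Hk; split=> // i j; exact: (Hk (i, j)).
Qed.

Section BaseField.
Variables (R : realType) (F : base_field).
Local Notation K := (field_of R F).
Local Notation C := (field_of R Complexes).
Local Notation iota := (@to_complex R F).
Local Notation Re := complex.Re.
Local Notation Im := complex.Im.

Fact to_complex_zmod_morphism : zmod_morphism iota.
Proof. by case: F => //= x y; rewrite rmorphB. Qed.

Fact to_complex_monoid_morphism : monoid_morphism iota.
Proof. by case: F => //=; split=> // x y; rewrite rmorphM. Qed.

HB.instance Definition _ :=
  GRing.isZmodMorphism.Build K C iota to_complex_zmod_morphism.
HB.instance Definition _ :=
  GRing.isMonoidMorphism.Build K C iota to_complex_monoid_morphism.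

Lemma to_complex_of_real (t : R) : iota (of_real F t) = t%:C.
Proof. by case: F. Qed.

(** Over R the imaginary parts of the sequence vanish, so the limit is real. Over C the modulus is
    at most the sum of the moduli of the two parts. *)
Lemma cvg_of_ccvg (a : nat -> K) (l : C) :
  ccvg (fun k => iota (a k)) l -> exists2 b, iota b = l & a @ \oo --> b.
Proof.
case: F a => /= a [a1 a2].
  exists (Re l) => //; apply: complex_eqP => //=.
  exact: (cvg_unique _ (cvg_cst 0) a2).
(* A positive element of C is a positive real number, so [e] has zero imaginary part. *)
exists l => //; apply/(@cvgrPdist_lt _ C) => e; rewrite ltcE/= => /andP[/eqP e1 e2].
have h0 : 0 < Re e / 2 by rewrite divr_gt0.
have /cvgrPdist_lt/(_ _ h0) H1 := a1.
have /cvgrPdist_lt/(_ _ h0) H2 := a2.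
near=> k; have w1 : `|Re l - Re (a k)| < Re e / 2 by near: k.
have w2 : `|Im l - Im (a k)| < Re e / 2 by near: k.
have -> : e = (Re e)%:C by case: (e) e1 => ? ? /= ->.
rewrite -ReN -ReD in w1; rewrite -ImN -ImD in w2.
set w := l - a k in w1 w2 *.
rewrite [w]complexE (le_lt_trans (ler_normD _ _))// normrM.
rewrite (_ : `|'i%C| = 1) ?mul1r; last first.
  by rewrite normc_def/= expr0n expr1n/= add0r sqrtr1.
rewrite !(normc_def _%:C)/= expr0n/= !addr0 !sqrtr_sqr -rmorphD ltcR.
by rewrite (splitr (Re e)) ltrD.
Unshelve. all: by end_near.
Qed.

(** The real and imaginary parts of a coordinate are continuous, additive and homogeneous for real
    factors, so they pass through the difference quotient. *)
Lemma cderiv_solution n f (D : set R) (x : R -> 'cV[K]_n) t i :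
  is_solution f D x -> D t ->
  cderiv (fun s => iota (x s i 0)) t (iota (f (x t) i 0)).
Proof.
move=> sol Dt.
have H : (fun h : R => (of_real F h)^-1 * (x (t + h) i 0 - x t i 0)) @ 0^'
           --> f (x t) i 0.
  rewrite (_ : (fun h => _) = fun h : R =>
      ((of_real F h)^-1 *: (x (t + h) - x t)) i 0); last first.
    by apply/funext => h; rewrite !mxE.
  have := @continuous_cvg _ _ _ _ _
    (fun h : R => (of_real F h)^-1 *: (x (t + h) - x t))
    (fun M : 'cV[K]_n => M i 0) (f (x t)).
  apply; last exact: sol.
  exact: coord_continuous.
have key (g : K -> R) : continuous g -> (forall a b, g (a - b) = g a - g b) ->
    (forall (h : R) b, g ((of_real F h)^-1 * b) = h^-1 * g b) ->
    is_derive t 1 (fun s => g (x s i 0)) (g (f (x t) i 0)).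
  move=> gc gB gZ.
  have E : (fun h : R => h^-1 *: (((fun s => g (x s i 0)) \o shift t)
      (h *: (1 : R)) - g (x t i 0))) @ 0^' --> g (f (x t) i 0).
    rewrite (_ : (fun h : R => _) = g \o
        (fun h : R => (of_real F h)^-1 * (x (t + h) i 0 - x t i 0))).
      exact: continuous_cvg (gc _) H.
    by apply/funext => h; rewrite /= gZ gB [h *: 1]mulr1 (addrC t).
  by apply: DeriveDef; [apply/cvg_ex; eexists; exact: E | exact/cvg_lim].
split.
  apply: (key (fun z => Re (iota z))).
  - by case: F {x sol f H key} => /=; [move=> z; exact: cvg_id|exact: Re_continuous].
  - by move=> a b; rewrite rmorphB ReD ReN.
  - move=> h b; rewrite rmorphM/= fmorphV/= to_complex_of_real ReM.
    by rewrite -fmorphV/= mul0r subr0.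
apply: (key (fun z => Im (iota z))).
- by case: F {x sol f H key} => /=; [move=> z; exact: cvg_cst|exact: Im_continuous].
- by move=> a b; rewrite rmorphB ImD ImN.
- move=> h b; rewrite rmorphM/= fmorphV/= to_complex_of_real ImM.
  by rewrite -fmorphV/= mul0r addr0.
Qed.

Lemma mulmx_diagX n (P A : 'M[C]_n) (d : 'rV_n) k :
  P *m A = diag_mx d *m P -> P *m A ^+ k = diag_mx (\row_i d 0 i ^+ k) *m P.
Proof.
move=> PA; elim: k => [|k IH].
  rewrite expr0 mulmx1 (_ : \row__ _ = const_mx 1) ?diag_const_mx ?mul1mx//.
  by apply/rowP => i; rewrite !mxE expr0.
rewrite exprSr -mulmxE mulmxA IH -mulmxA PA mulmxA mulmx_diag.
congr (diag_mx _ *m _).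
by apply/rowP => i; rewrite !mxE exprSr.
Qed.

(** Conjugation by [P] turns each partial sum of the exponential series into a diagonal matrix with
    entries [exp_partial], and these tend to [cexp]. *)
Lemma expm_diag n (B : 'M[K]_n) (P : 'M[C]_n) (d : 'rV_n) (t : R) :
  P \in unitmx -> P *m map_mx iota B = diag_mx d *m P ->
  P *m map_mx iota (expm (of_real F t *: B)) =
    diag_mx (\row_i cexp (t%:C * d 0 i)) *m P.
Proof.
move=> Pu PB.
set M := series (fun k : nat => (k`!%:R)^-1 *: ((of_real F t *: B) ^+ k)).
pose DN N := diag_mx (\row_i exp_partial N (t%:C * d 0 i)).
pose E := invmx P *m diag_mx (\row_i cexp (t%:C * d 0 i)) *m P.
have ME N : map_mx iota (M N) = invmx P *m DN N *m P.
  apply: (can_inj (mulKmx Pu)); rewrite -!mulmxA mulKVmx//.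
  rewrite /M /series /= big_mkord map_mx_sum mulmx_sumr.
  under eq_bigr => k _.
    rewrite map_mxZ rmorphXn /= map_mxZ /= -scalemxAr.
    rewrite (mulmx_diagX k (d := \row_i (t%:C * d 0 i))); last first.
      rewrite -scalemxAr PB scalemxAl; congr (_ *m _); apply/matrixP => i j.
      by rewrite !mxE mulrnAr to_complex_of_real.
    rewrite scalemxAl; over.
  rewrite -mulmx_suml; congr (_ *m _); apply/matrixP => i j.
  rewrite summxE !mxE /exp_partial -sumrMnl; apply: eq_bigr => k _.
  by rewrite !mxE fmorphV rmorph_nat mulrnAr.
have cE i j : ccvg (fun N => iota (M N i j)) (E i j).
  have -> : (fun N => iota (M N i j)) = fun N => \sum_k
      (invmx P i k * P k j) * exp_partial N (t%:C * d 0 k).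
    apply/funext => N; have /matrixP/(_ i j) := ME N; rewrite mxE => ->.
    rewrite !mxE; apply: eq_bigr => k _.
    by rewrite mul_mx_diag !mxE; ring.
  have -> : E i j = \sum_k (invmx P i k * P k j) * cexp (t%:C * d 0 k).
    rewrite !mxE; apply: eq_bigr => k _.
    by rewrite mul_mx_diag !mxE; ring.
  by apply: ccvg_sum => k; apply: ccvgM; [exact: ccvg_cst|exact: exp_partial_cvg].
(* The limit [E] is computed over C; its entries come from K because those of the partial sums
   do. *)
have [L LE] : {L : 'M[K]_n | forall i j,
    iota (L i j) = E i j /\ (fun N => M N i j) @ \oo --> L i j}.
  have /choice[L' HL'] : forall p : 'I_n * 'I_n, exists b,
      iota b = E p.1 p.2 /\ (fun N => M N p.1 p.2) @ \oo --> b.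
    by move=> p; have [b ? ?] := cvg_of_ccvg (cE p.1 p.2); exists b.
  by exists (\matrix_(i, j) L' (i, j)) => i j; rewrite mxE; exact: (HL' (i, j)).
have -> : expm (of_real F t *: B) = L.
  apply: cvg_lim; first exact: norm_hausdorff.
  by apply: cvg_mx_entries => i j; case: (LE i j).
have -> : map_mx iota L = E by apply/matrixP => i j; rewrite mxE; case: (LE i j).
by rewrite /E -mulmxA mulKVmx.
Qed.

End BaseField.

(** * Exponential polynomials *)

Section ExponentialPolynomials.
Variable R : realType.
Implicit Types (u v b : R -> R[i]) (t : R) (z w : R[i]) (D : set R).

(** A class of elementary functions closed under products and antiderivatives; the components of all
    solutions are found in it. *)
Inductive exp_poly : (R -> R[i]) -> Prop :=
| exp_poly_term c k z : exp_poly (fun t => c * t%:C ^+ k * cexp (t%:C * z))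
| exp_polyD u v : exp_poly u -> exp_poly v -> exp_poly (fun t => u t + v t).

Lemma exp_poly_cst c : exp_poly (fun=> c).
Proof.
have := exp_poly_term c 0 0; congr exp_poly.
by apply/funext => t; rewrite expr0 mulr0 cexp0 !mulr1.
Qed.

Lemma exp_polyM u v : exp_poly u -> exp_poly v -> exp_poly (fun t => u t * v t).
Proof.
elim=> [c k z|{}u u' _ IHu _ IHu'] ep_v; last first.
  by under eq_fun do rewrite mulrDl; apply: exp_polyD; [exact: IHu|exact: IHu'].
elim: ep_v => [d l w|{}v v' _ IHv _ IHv']; last first.
  by under eq_fun do rewrite mulrDr; exact: exp_polyD.
have := exp_poly_term (c * d) (k + l) (z + w); congr exp_poly.
by apply/funext => t; rewrite mulrDr cexpD exprD; ring.
Qed.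

Lemma exp_poly_elementary D u : exp_poly u -> elementary D u.
Proof.
elim=> [c k z|{}u v _ IHu _ IHv]; last exact: elem_add.
apply: elem_mul; last first.
  by apply/elem_exp/elem_mul; [exact: elem_time|exact: elem_const].
apply: elem_mul; first exact: elem_const.
elim: k => [|k IH]; first by under eq_fun do rewrite expr0; exact: elem_const.
by under eq_fun do rewrite exprS; apply: elem_mul => //; exact: elem_time.
Qed.

(** Integration by parts lowers the power of t. It divides by [z], so [z = 0] is treated apart as
    the integral of a power. *)
Lemma exp_poly_antiderivative u : exp_poly u ->
  exists2 v, exp_poly v & forall t, cderiv v t (u t).
Proof.
elim=> [c k z|{}u u' _ [v ev dv] _ [v' ev' dv']]; last first.
  exists (fun t => v t + v' t); first exact: exp_polyD.
  by move=> t; exact: cderivD.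
have dX l t : cderiv (fun s => s%:C ^+ l.+1) t (l.+1%:R * t%:C ^+ l).
  by apply: (cderiv_eq (cderivX l (cderiv_time t))); rewrite mulr1.
have [->|z0] := eqVneq z 0.
  exists (fun t => c / k.+1%:R * t%:C ^+ k.+1 * cexp (t%:C * 0)).
    exact: exp_poly_term.
  move=> t; under eq_fun do rewrite mulr0 cexp0 mulr1.
  apply: (cderiv_eq (cderivZ _ (dX k t))); rewrite mulr0 cexp0 mulr1.
  by rewrite mulrA divfK// pnatr_eq0.
elim: k c => [|k IH] c.
  exists (fun t => c / z * t%:C ^+ 0 * cexp (t%:C * z)); first exact: exp_poly_term.
  move=> t; under eq_fun do rewrite expr0 mulr1.
  apply: (cderiv_eq (cderivZ _ (cderiv_cexp z t))).
  by rewrite mulrA divfK// expr0 mulr1.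
(* The term that remains after integrating [c * t^(k+1) * exp (t z)] by parts. *)
have [v ev dv] := IH (- (c / z) * k.+1%:R).
exists (fun t => c / z * t%:C ^+ k.+1 * cexp (t%:C * z) + v t).
  by apply: exp_polyD => //; exact: exp_poly_term.
move=> t; apply: (cderiv_eq (cderivD
  (cderivM (cderivZ (c / z) (dX k t)) (cderiv_cexp z t)) (dv t))).
by rewrite exprS; field.
Qed.

(** A solution is controlled on its domain only, where it agrees with a globally defined exponential
    polynomial. *)
Definition exp_poly_on D u := exists2 v, exp_poly v & forall t, D t -> u t = v t.

Lemma exp_poly_on_cst D c : exp_poly_on D (fun=> c).
Proof. by exists (fun=> c) => //; exact: exp_poly_cst. Qed.

Lemma exp_poly_onD D u v : exp_poly_on D u -> exp_poly_on D v ->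
  exp_poly_on D (fun t => u t + v t).
Proof.
move=> [u' eu uu'] [v' ev vv']; exists (fun t => u' t + v' t).
  exact: exp_polyD.
by move=> t Dt; rewrite uu'// vv'.
Qed.

Lemma exp_poly_onM D u v : exp_poly_on D u -> exp_poly_on D v ->
  exp_poly_on D (fun t => u t * v t).
Proof.
move=> [u' eu uu'] [v' ev vv']; exists (fun t => u' t * v' t).
  exact: exp_polyM.
by move=> t Dt; rewrite uu'// vv'.
Qed.

Lemma exp_poly_onX D u k : exp_poly_on D u -> exp_poly_on D (fun t => u t ^+ k).
Proof.
move=> eu; elim: k => [|k IH].
  by under eq_fun do rewrite expr0; exact: exp_poly_on_cst.
by under eq_fun do rewrite exprS; exact: exp_poly_onM.
Qed.

Lemma exp_poly_on_sum D (I : Type) (r : seq I) (P : pred I) (u : I -> R -> R[i]) :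
  (forall i, P i -> exp_poly_on D (u i)) ->
  exp_poly_on D (fun t => \sum_(i <- r | P i) u i t).
Proof.
move=> eu; elim: r => [|i r IH].
  by under eq_fun do rewrite big_nil; exact: exp_poly_on_cst.
under eq_fun do rewrite big_cons.
by case: (boolP (P i)) => [Pi|//]; apply: exp_poly_onD => //; exact: eu.
Qed.

Lemma exp_poly_on_prod D (I : Type) (r : seq I) (u : I -> R -> R[i]) :
  (forall i, exp_poly_on D (u i)) ->
  exp_poly_on D (fun t => \prod_(i <- r) u i t).
Proof.
move=> eu; elim: r => [|i r IH].
  by under eq_fun do rewrite big_nil; exact: exp_poly_on_cst.
by under eq_fun do rewrite big_cons; exact: exp_poly_onM.
Qed.

Lemma exp_poly_on_elementary D u : exp_poly_on D u -> elementary D u.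
Proof. by move=> [v /(exp_poly_elementary D) ev uv]; exact: (elem_ext ev). Qed.

Lemma exp_poly_on_eq D u v : exp_poly_on D u -> (forall t, D t -> v t = u t) ->
  exp_poly_on D v.
Proof. by move=> [w ew uw] vu; exists w => // t Dt; rewrite vu// uw. Qed.

(** Integrating factor: if [V] is an antiderivative of [exp (- a t) * b'], then
    [exp (- a t) * u - V] has derivative zero on the interval [D] and is constant there. *)
Lemma scalar_linear_ode D a b u : is_interval D -> exp_poly_on D b ->
  (forall t, D t -> cderiv u t (a * u t + b t)) -> exp_poly_on D u.
Proof.
move=> iD [b' eb' bb'] du.
(* The constant of integration is read off at a point [t0], so the empty domain is settled first. *)
have [D0|/set0P[t0 Dt0]] := eqVneq D set0.
  by exists (fun=> 0); [exact: exp_poly_cst|move=> t; rewrite D0].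
have ecexp z : exp_poly (fun t => cexp (t%:C * z)).
  have := exp_poly_term 1 0 z; congr exp_poly.
  by apply/funext => t; rewrite expr0 !mul1r.
have [V eV dV] := exp_poly_antiderivative (exp_polyM (ecexp (- a)) eb').
pose g t := cexp (t%:C * - a) * u t - V t.
have dg t : D t -> cderiv g t 0.
  move=> Dt; apply: (cderiv_eq
    (cderivB (cderivM (cderiv_cexp (- a) t) (du t Dt)) (dV t))).
  by rewrite bb'//; ring.
exists (fun t => cexp (t%:C * a) * (g t0 + V t)).
  by apply: exp_polyM => //; apply: exp_polyD => //; exact: exp_poly_cst.
move=> t Dt; rewrite (cderiv0_itv_const iD dg Dt0 Dt) /g subrK mulrA -cexpD.
by rewrite mulrN subrr cexp0 mul1r.
Qed.

(* By Cayley-Hamilton, applying the factors [A - mu] of the characteristic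
   polynomial successively to a solution ends in [0]; going back, each step is
   a scalar equation for every coordinate. *)
Lemma linear_ode n (A : 'M[R[i]]_n) D (b x : R -> 'cV[R[i]]_n) :
  is_interval D ->
  (forall i, exp_poly_on D (fun t => b t i 0)) ->
  (forall t i, D t ->
     cderiv (fun s => x s i 0) t ((A *m x t) i 0 + b t i 0)) ->
  forall i, exp_poly_on D (fun t => x t i 0).
Proof.
(* In dimension 0 there is no coordinate; in positive dimension the matrices form the ring in which
   [horner_mx] evaluates. *)
case: n A b x => [? ? ? ? ? ? []//|n] A b x iD.
suff H (s : seq R[i]) : forall b x : R -> 'cV[R[i]]_n.+1,
    (forall i, exp_poly_on D (fun t => b t i 0)) ->
    (forall t i, D t ->
       cderiv (fun s => x s i 0) t ((A *m x t) i 0 + b t i 0)) ->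
    (forall t, D t ->
       horner_mx A (\prod_(mu <- s) ('X - mu%:P)) *m x t = 0) ->
    forall i, exp_poly_on D (fun t => x t i 0).
  have [s sE] := closed_field_poly_normal (char_poly A).
  move=> eb dx; apply: (H s) => // t Dt.
  have := Cayley_Hamilton A; rewrite sE (monicP (char_poly_monic A)) scale1r.
  by move=> ->; rewrite mul0mx.
elim: s => [|mu s IH] {}b {}x eb dx.
  rewrite big_nil rmorph1 => x0 i; exists (fun=> 0); first exact: exp_poly_cst.
  by move=> t /x0; rewrite mul1mx => ->; rewrite mxE.
rewrite big_cons mulrC rmorphM/= rmorphB/= horner_mx_X horner_mx_C => x0 i.
pose L := A - mu%:M.
have eMb (M : 'M[R[i]]_n.+1) j : exp_poly_on D (fun t => (M *m b t) j 0).
  under eq_fun do rewrite mxE.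
  apply: exp_poly_on_sum => k _; apply: exp_poly_onM => //.
  exact: exp_poly_on_cst.
(* As [L] commutes with [A], [L *m x] solves the system with forcing [L *m b], and the remaining
   factors annihilate it. *)
have eLx j : exp_poly_on D (fun t => (L *m x t) j 0).
  apply: (IH (fun t => L *m b t)) => [//|t k Dt|t Dt]; last first.
    by rewrite mulmxA; exact: x0.
  under eq_fun do rewrite mxE.
  apply: cderiv_eq; first by apply: cderiv_sum => l _; exact: cderivZ (dx t l Dt).
  have -> : A *m (L *m x t) = L *m (A *m x t).
    by rewrite !mulmxA mulmxBl mulmxBr scalar_mxC.
  by rewrite !mxE -big_split; apply: eq_bigr => l _; rewrite mulrDr.
(* Since [A = mu + L], the coordinate [x_i] satisfies a scalar equation with forcing
   [(L x)_i + b_i]. *)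
apply: (scalar_linear_ode (a := mu) iD (exp_poly_onD (eLx i) (eb i))).
move=> t Dt; apply: (cderiv_eq (dx t i Dt)).
by rewrite addrA; congr (_ + _); rewrite mulmxBl mul_scalar_mx !mxE; ring.
Qed.

End ExponentialPolynomials.

(** * Polynomials on K^n and invariants *)

(* Multiplying by [exp (- t mu0)] and differentiating removes the term [mu0]. *)
Lemma exp_lin_indep (R : realType) (s : seq R[i]) (a : R[i] -> R[i]) :
  uniq s -> (forall t : R, \sum_(mu <- s) a mu * cexp (t%:C * mu) = 0) ->
  {in s, forall mu, a mu = 0}.
Proof.
elim: s a => [//|mu0 s IH] a /= /andP[mu0s us] H.
have a0 : {in s, forall mu, a mu = 0}.
  pose b mu := a mu * (mu - mu0).
  have b0 : {in s, forall mu, b mu = 0}.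
    apply: IH => // t.
    pose g t := cexp (t%:C * - mu0) * \sum_(mu <- mu0 :: s) a mu * cexp (t%:C * mu).
    have g0 : cderiv g t 0.
      rewrite /g; under eq_fun do rewrite H mulr0.
      exact: cderiv_cst.
    have := cderivM (cderiv_cexp (- mu0) t) (cderiv_sum (mu0 :: s) (P := predT)
       (fun mu _ => cderivZ (a mu) (cderiv_cexp mu t))).
    move=> /(cderiv_unique g0)/esym; rewrite mulr_sumr mulr_sumr -big_split/=.
    rewrite big_cons => E; apply: (mulfI (cexp_neq0 (t%:C * - mu0))).
    rewrite mulr0 -[RHS]E.
    rewrite [X in X + _](_ : _ = 0) ?add0r; last by ring.
    by rewrite mulr_sumr; apply: eq_bigr => mu _; rewrite /b; ring.
  move=> mu mus; have /eqP := b0 mu mus.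
  rewrite mulf_eq0 subr_eq0 => /orP[/eqP//|/eqP mE].
  by move: mu0s; rewrite -mE mus.
move=> mu; rewrite inE => /orP[/eqP->|/a0//].
have := H 0; rewrite big_cons big_seq big1 => [|nu nus]; last by rewrite a0// mul0r.
by rewrite mul0r cexp0 mulr1 addr0.
Qed.

Section Polynomials.

Lemma meval_linear_subst (K : comNzRingType) (n m : nat) (p : mpoly.mpoly n K)
    (L : 'I_n -> 'I_m -> K) :
  exists q : mpoly.mpoly m K, forall v,
    mpoly.meval v q = mpoly.meval (fun i => \sum_j L i j * v j) p.
Proof.
exists (mpoly.comp_mpoly
  [tuple \sum_j L i j *: mpoly.mpolyX K (mpoly.mnm1 j) | i < n] p) => v.
rewrite mpoly.comp_mpoly_meval; apply: mpoly.meval_eq => i.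
rewrite tnth_mktuple raddf_sum/=; apply: eq_bigr => j _.
by rewrite mpoly.mevalZ mpoly.mevalXU.
Qed.

(** This makes the invariance of [phi] a Zariski-closed condition on [T]. *)
Lemma polynomial_fun_orbit (K : numFieldType) (n : nat) (phi : 'cV[K]_n -> K)
    (x : 'cV[K]_n) : polynomial_fun phi ->
  exists q : mpoly.mpoly (n * n) K, forall T, mx_eval q T = phi (T *m x).
Proof.
move=> [p phiE].
have [q qE] := meval_linear_subst p
  (* In coordinate [i] of [T *m x], the variable numbered [k] has coefficient [x_j] if it is the
     entry (i, j), and 0 if it lies in another row. *)
  (fun (i : 'I_n) (k : 'I_(n * n)) => \sum_j (k == mxvec_index i j)%:R * x j 0).
exists q => T; rewrite /mx_eval qE phiE; apply: mpoly.meval_eq => i.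
rewrite mxE; under eq_bigr do rewrite mulr_suml.
rewrite exchange_big/=; apply: eq_bigr => j _.
rewrite (bigD1 (mxvec_index i j))//= eqxx mul1r mxvecE mulrC.
rewrite big1 ?addr0// => k /negPf kij.
by rewrite kij !mul0r.
Qed.

(** The matrices fixing [phi] form a closed set, cut out by one polynomial for each point [x]. It
    contains [S], hence [G]. *)
Lemma zariski_dense_invariant (K : numFieldType) (n : nat) (S G : set 'M[K]_n)
    (phi : 'cV[K]_n -> K) :
  zariski_dense_in S G -> polynomial_fun phi ->
  (forall T, S T -> forall x, phi (T *m x) = phi x) ->
  forall T, G T -> forall x, phi (T *m x) = phi x.
Proof.
move=> [_ dense] pphi inv.
pose Z := [set T : 'M[K]_n | forall x, phi (T *m x) = phi x].
suff ZZ : zariski_closed Z by exact: (dense Z ZZ inv).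
exists [set p | exists x, forall T, mx_eval p T = phi (T *m x) - phi x].
apply/seteqP; split=> T /=.
  by move=> ZT p [x pE]; rewrite pE ZT subrr.
move=> H x; have [q qE] := polynomial_fun_orbit x pphi.
apply/eqP; rewrite -subr_eq0; apply/eqP.
pose c : mpoly.mpoly (n * n) K := mpoly.mpolyC (n * n) (phi x).
have cE T' : mx_eval (q - c) T' = phi (T' *m x) - phi x.
  by rewrite /mx_eval mpoly.mevalB mpoly.mevalC -/(mx_eval q T') qE.
by rewrite -cE; apply: H; exists x.
Qed.

Lemma poly_nat_roots (K : numFieldType) (q : {poly K}) :
  (forall k : nat, q.[k%:R] = 0) -> q = 0.
Proof.
move=> q0; apply: (@roots_geq_poly_eq0 _ _ [seq k%:R | k <- iota 0 (size q)]).
- by apply/allP => _ /mapP[k _ ->]; rewrite /root q0.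
- by rewrite map_inj_uniq ?iota_uniq//; exact: (mulrIn (oner_neq0 K)).
- by rewrite size_map size_iota.
Qed.

Variables (R : realType) (F : base_field) (n : nat).
Local Notation K := (field_of R F).
Local Notation C := (field_of R Complexes).
Local Notation iota := (@to_complex R F).

(* A complex line [a + z b] with [a], [b] real meets K^n in infinitely many
   points. *)
Lemma meval_eq0_complex (p : mpoly.mpoly n C) :
  (forall x : 'cV[K]_n, mpoly.meval (fun i => iota (x i 0)) p = 0) ->
  forall y, mpoly.meval y p = 0.
Proof.
move=> p0 y.
(* The line has real points at natural parameters, where [p] vanishes, and passes through [y] at the
   parameter i. *)
pose l i : {poly C} := (complex.Re (y i))%:C%:P + (complex.Im (y i))%:C *: 'X.
pose q : {poly C} := mpoly.mmap polyC l p.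
have qE z : q.[z] = mpoly.meval
    (fun i => (complex.Re (y i))%:C + (complex.Im (y i))%:C * z) p.
  rewrite /q /mpoly.mmap horner_sum mpoly.mevalE; apply: eq_bigr => m _.
  rewrite hornerM hornerC; congr (_ * _); rewrite /mpoly.mmap1 horner_prod.
  by apply: eq_bigr => i _; rewrite horner_exp !hornerE.
have q0 : q = 0.
  apply: poly_nat_roots => k; rewrite qE.
  rewrite -[RHS](p0 (\col_i
    of_real F (complex.Re (y i) + complex.Im (y i) * k%:R))).
  apply: mpoly.meval_eq => i; rewrite mxE to_complex_of_real rmorphD rmorphM/=.
  by rewrite rmorph_nat.
have := qE 'i%C; rewrite q0 horner0 => ->.
by apply: mpoly.meval_eq => i; rewrite [LHS]complexE; congr (_ + _); exact: mulrC.
Qed.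

(** Splits a complex invariant on R^n into two real ones, to which the triviality of the real
    invariant algebra applies. *)
Lemma meval_real_parts (p : mpoly.mpoly n R[i]) :
  exists p1 p2 : mpoly.mpoly n R, forall x,
    mpoly.meval (fun i => (x i)%:C) p = mpoly.meval x p1 +i* mpoly.meval x p2.
Proof.
pose part (g : R[i] -> R) : mpoly.mpoly n R :=
  \sum_(m <- mpoly.msupp p) g (mpoly.mcoeff m p) *: mpoly.mpolyX R m.
have partE g x : mpoly.meval x (part g) =
    \sum_(m <- mpoly.msupp p) g (mpoly.mcoeff m p) * \prod_i x i ^+ m i.
  rewrite raddf_sum/=; apply: eq_bigr => m _.
  by rewrite mpoly.mevalZ mpoly.mevalX.
exists (part (@complex.Re R)), (part (@complex.Im R)) => x.
rewrite !partE mpoly.mevalE.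
elim/big_rec3: _ => [//|m b a _ _ ->].
have -> : \prod_i (x i)%:C ^+ m i = (\prod_i x i ^+ m i)%:C.
  by rewrite rmorph_prod; apply: eq_bigr => i _; rewrite rmorphXn.
by apply: complex_eqP; rewrite /= ?ReD ?ImD ?ReM ?ImM/=; ring.
Qed.

(** Over K, invariance extends from [S] to [G] by density, and triviality gives constancy. Complex
    coefficients over R are handled by real and imaginary parts, and constancy on K^n extends to
    C^n. *)
Lemma complex_invariant_const (S G : set 'M[K]_n) (p : mpoly.mpoly n C) :
  zariski_dense_in S G -> is_subgroup_GL G ->
  invariant_algebra G = [set cst c | c in [set: K]] ->
  (forall T, S T -> forall x : 'cV[K]_n,
     mpoly.meval (fun i => iota ((T *m x) i 0)) p =
     mpoly.meval (fun i => iota (x i 0)) p) ->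
  forall y z, mpoly.meval y p = mpoly.meval z p.
Proof.
move=> dense [_ _ _ GV] trivial inv.
have const (q : mpoly.mpoly n K) : (forall T, S T -> forall x : 'cV[K]_n,
    mpoly.meval (fun i => (T *m x) i 0) q = mpoly.meval (fun i => x i 0) q) ->
    forall x : 'cV[K]_n, mpoly.meval (fun i => x i 0) q =
      mpoly.meval (fun i => (0 : 'cV[K]_n) i 0) q.
  move=> invq.
  pose phi (x : 'cV[K]_n) := mpoly.meval (fun i => x i 0) q.
  have pphi : polynomial_fun phi by exists q.
  have : invariant_algebra G phi.
    (* Invariance is defined through the inverse of [T], hence the closure of [G] under inverses. *)
    split=> // T /GV GT x.
    exact: (zariski_dense_invariant dense pphi invq GT).
  by rewrite trivial => -[c _ cE] x; rewrite -/(phi x) -/(phi 0) -cE.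
have constx (x : 'cV[K]_n) : mpoly.meval (fun i => iota (x i 0)) p =
    mpoly.meval (fun i => iota ((0 : 'cV[K]_n) i 0)) p.
  case: F S G p x const inv {dense GV trivial} => /= S G p x const inv.
    have [p1 [p2 pE]] := meval_real_parts p.
    rewrite !pE; congr (_ +i* _); apply: const => T ST y; have := inv T ST y;
      by rewrite !pE => -[].
  exact: const.
set c := mpoly.meval (fun i => iota ((0 : 'cV[K]_n) i 0)) p in constx.
suff H y : mpoly.meval y p = c by move=> y z; rewrite !H.
have := @meval_eq0_complex (p - mpoly.mpolyC n c) _ y.
rewrite mpoly.mevalB mpoly.mevalC => H; apply/eqP; rewrite -subr_eq0.
apply/eqP/H => x; by rewrite mpoly.mevalB mpoly.mevalC constx subrr.
Qed.

End Polynomials.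

(** * Resonant monomials *)

Section Resonance.
Variables (R : realType) (n : nat) (lam : 'I_n -> R[i]).
Implicit Types (mu nu : R[i]) (y : 'I_n -> R[i]).

Definition weight (m : 'I_n -> nat) : R[i] := \sum_i lam i *+ m i.

Definition precedes nu mu :=
  exists m, (exists i, m i != 0) /\ mu = nu + weight m.

Definition spectrum := undup [seq lam i | i <- enum 'I_n].

(** Counting predecessors turns the partial order into a number that increases strictly along it;
    see [rank_lt]. *)
Definition rank mu := count (fun nu => `[< precedes nu mu >]) spectrum.

Lemma weightD m m' : weight (fun i => m i + m' i)%N = weight m + weight m'.
Proof. by rewrite /weight -big_split; apply: eq_bigr => i _; rewrite mulrnDr. Qed.

Lemma weight_delta i : weight (fun k => k == i : nat) = lam i.
Proof.
rewrite /weight (bigD1 i)//= eqxx mulr1n big1 ?addr0// => k /negPf ->.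
by rewrite mulr0n.
Qed.

Lemma precedes_trans mu1 mu2 mu3 :
  precedes mu1 mu2 -> precedes mu2 mu3 -> precedes mu1 mu3.
Proof.
move=> [m [[i mi] ->]] [m' [_ ->]]; exists (fun i => m i + m' i)%N; split.
  by exists i; rewrite addn_eq0 negb_and mi.
by rewrite weightD addrA.
Qed.

Lemma mem_spectrum i : lam i \in spectrum.
Proof. by rewrite mem_undup; apply: map_f; rewrite mem_enum. Qed.

Lemma rank_le mu : (rank mu <= n)%N.
Proof.
apply: (leq_trans (count_size _ _)); apply: (leq_trans (size_undup _)).
by rewrite size_map size_enum_ord.
Qed.

(** The morphism [c] permutes the spectrum and preserves [precedes], hence preserves the count. It
    is applied to complex conjugation when K is R. *)
Lemma rank_fixed (c : {rmorphism R[i] -> R[i]}) mu :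
  involutive c -> (forall i, exists j, c (lam i) = lam j) ->
  rank (c mu) = rank mu.
Proof.
move=> cK clam.
have [s sE] := choice clam.
have prec_c a b : precedes a b -> precedes (c a) (c b).
  (* Exponents are transported along [s]. As eigenvalues may be repeated, [s] need not be injective,
     and exponents are added over its fibres. *)
  move=> [m [[i mi] ->]]; exists (fun k => \sum_(l | s l == k) m l)%N; split.
    exists (s i); rewrite (bigD1 i)//= addn_eq0 negb_and.
    by rewrite mi.
  rewrite rmorphD rmorph_sum/=; congr (_ + _).
  rewrite /weight (partition_big s xpredT)//=; apply: eq_bigr => k _.
  rewrite -sumrMnr; apply: eq_bigr => l /eqP <-.
  by rewrite rmorphMn /= sE.
have pE : perm_eq (map c spectrum) spectrum.
  apply: uniq_perm; rewrite ?undup_uniq ?map_inj_uniq ?undup_uniq//.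
    exact: inv_inj.
  have sub x : x \in spectrum -> c x \in spectrum.
    by rewrite mem_undup => /mapP[i _ ->]; rewrite sE mem_spectrum.
  move=> x; apply/mapP/idP => [[x' /sub ? ->//]|/sub cx].
  by exists (c x); rewrite ?cK.
rewrite /rank -(permP pE) count_map; apply: eq_count => nu /=.
apply/asboolP/asboolP => [/prec_c|/prec_c//].
by rewrite !cK.
Qed.

Definition rank_proj k : 'M[R[i]]_n :=
  diag_mx (\row_i (rank (lam i) == k)%:R).

Lemma rank_projE k (y : 'cV[R[i]]_n) j :
  (rank_proj k *m y) j 0 = (rank (lam j) == k)%:R * y j 0.
Proof. by rewrite mul_diag_mx mxE [X in X * _]mxE. Qed.

Lemma rank_ord_eq (l : 'I_n.+1) i :
  (rank (lam i) == l) = (l == inord (rank (lam i))).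
Proof.
by rewrite -val_eqE /= inordK ?ltnS ?rank_le// eq_sym.
Qed.

Lemma rank_proj_sum : \sum_(k < n.+1) rank_proj k = 1%:M.
Proof.
apply/matrixP => i j; rewrite summxE mxE; under eq_bigr do rewrite !mxE rank_ord_eq.
have [->|ij] := eqVneq i j; last by rewrite big1.
rewrite (bigD1 (inord (rank (lam j))))//= eqxx big1 ?addr0// => k /negPf ->.
by [].
Qed.

Lemma rank_projM (k l : 'I_n.+1) :
  rank_proj k *m rank_proj l = if k == l then rank_proj k else 0.
Proof.
rewrite /rank_proj mulmx_diag; have [->|kl] := eqVneq k l.
  congr diag_mx; apply/rowP => i; rewrite !mxE.
  by case: eqP; rewrite ?mulr1 ?mulr0.
apply/matrixP => i j; rewrite !mxE !rank_ord_eq -natrM mulnb.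
case: eqVneq => [<-|_ ]; last by rewrite mul0rn.
by rewrite eq_sym (negPf kl) mul0rn.
Qed.

Lemma rank_proj_low (k : 'I_n.+1) (y : 'cV[R[i]]_n) i :
  (\sum_(l < n.+1 | (l < k)%N) rank_proj l *m y) i 0 =
    if (rank (lam i) < k)%N then y i 0 else 0.
Proof.
rewrite summxE; under eq_bigr do rewrite rank_projE.
case: ltnP => ik.
  rewrite (bigD1 (inord (rank (lam i)))) ?inordK ?ltnS ?rank_le//= eqxx mul1r.
  rewrite big1 ?addr0// => l /andP[_ /negPf]; rewrite rank_ord_eq => ->.
  by rewrite mul0r.
rewrite big1// => l lk; rewrite (_ : _ == _ = false) ?mul0r//.
by apply/negbTE; rewrite neq_ltn (leq_trans lk ik) orbT.
Qed.

Hypothesis no_relation : forall m, weight m = 0 -> forall i, m i = 0%N.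

Lemma precedes_irrefl mu : ~ precedes mu mu.
Proof.
move=> [m [[i mi] E]].
have /no_relation/(_ i)/eqP : weight m = 0.
  by apply: (addrI mu); rewrite addr0 -E.
by rewrite (negPf mi).
Qed.

(** By transitivity every predecessor of [lam i] precedes [mu]; in addition [lam i] precedes [mu]
    but not itself. *)
Lemma rank_lt i mu : precedes (lam i) mu -> (rank (lam i) < rank mu)%N.
Proof.
move=> imu; rewrite /rank.
set a := fun nu => `[< precedes nu (lam i) >].
set b := fun nu => `[< precedes nu mu >].
have ab : subpred a b.
  by move=> nu /asboolP ai; apply/asboolP; exact: precedes_trans imu.
have -> : count b spectrum = (count a spectrum + count (predD b a) spectrum)%N.
  rewrite -!sum1_count (bigID a)/=; congr (_ + _)%N; apply: eq_bigl => nu /=.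
    by apply: andb_idl; exact: ab.
  exact: andbC.
rewrite -[X in (X < _)%N]addn0 ltn_add2l -has_count; apply/hasP.
exists (lam i); first exact: mem_spectrum.
apply/andP; split; last exact/asboolP.
by apply/asboolP; exact: precedes_irrefl.
Qed.

Lemma cexp_weight (t : R) m :
  \prod_i cexp (t%:C * lam i) ^+ m i = cexp (t%:C * weight m).
Proof.
rewrite /weight mulr_sumr.
elim/big_rec2: _ => [|i a b _ ->]; first by rewrite cexp0.
rewrite cexpD; congr (_ * _); rewrite mulrnAr.
elim: (m i) => [|k IH]; first by rewrite mulr0n cexp0.
by rewrite exprS mulrS cexpD IH.
Qed.

(** For fixed [y] both sides of the hypothesis are exponential sums in t, and linear independence of
    exponentials allows comparing coefficients. *)
Lemma resonant_eval (p : mpoly.mpoly n R[i]) mu :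
  (forall t y, mpoly.meval (fun i => cexp (t%:C * lam i) * y i) p =
     cexp (t%:C * mu) * mpoly.meval y p) ->
  forall y, mpoly.meval y p =
    \sum_(m <- mpoly.msupp p | weight m == mu)
      mpoly.mcoeff m p * \prod_i y i ^+ m i.
Proof.
move=> H y.
pose T (m : mpoly.multinom n) := mpoly.mcoeff m p * \prod_i y i ^+ m i.
(* The coefficient of [exp (t nu)] in the difference of the two sides. *)
pose a nu := \sum_(m <- mpoly.msupp p | weight m == nu) T m
  - (nu == mu)%:R * mpoly.meval y p.
(* [mu] is listed even if no monomial of [p] has this weight. *)
pose s := undup (mu :: [seq weight m | m : mpoly.multinom n <- mpoly.msupp p]).
have mus : mu \in s by rewrite mem_undup inE eqxx.
suff /(_ mu mus)/eqP : {in s, forall nu, a nu = 0}.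
  by rewrite /a eqxx mul1r subr_eq0 eq_sym => /eqP.
apply: exp_lin_indep; first exact: undup_uniq.
move=> t; rewrite /a; under eq_bigr => nu _ do rewrite mulrBl.
rewrite sumrB; apply/eqP; rewrite subr_eq0; apply/eqP.
rewrite [RHS](bigD1_seq mu)/= ?undup_uniq// eqxx mul1r
  [X in _ = _ + X]big1 ?addr0; last first.
  by move=> nu numu; rewrite (negPf numu) !mul0r.
rewrite mulrC -H mpoly.mevalE.
under eq_bigr do rewrite mulr_suml.
rewrite (exchange_big_dep xpredT)//= big_seq [RHS]big_seq; apply: eq_bigr => m mp.
under eq_bigl do rewrite eq_sym.
rewrite -big_filter filter_pred1_uniq ?undup_uniq ?big_seq1//; last first.
  by rewrite mem_undup inE; apply/orP; right; apply/mapP; exists m.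
rewrite /T -mulrA -cexp_weight -big_split/=; congr (_ * _).
by apply: eq_bigr => i _; rewrite exprMn [RHS]mulrC.
Qed.

(** A resonant linear monomial involves a variable with eigenvalue [lam j]. In any other resonant
    monomial all variables have eigenvalues preceding [lam j], so setting those of higher or equal
    rank to 0 does not change it. *)
Lemma graded_eval (p : mpoly.mpoly n R[i]) j :
  (forall t y, mpoly.meval (fun i => cexp (t%:C * lam i) * y i) p =
     cexp (t%:C * lam j) * mpoly.meval y p) ->
  mpoly.meval (fun=> 0) p = 0 /\
  exists A : 'I_n -> R[i],
    (forall i, A i != 0 -> lam i = lam j) /\
    forall y, mpoly.meval y p = \sum_i A i * y i +
      mpoly.meval (fun i => if (rank (lam i) < rank (lam j))%N then y i else 0) p.
Proof.
move=> /resonant_eval E.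
(* A resonant constant monomial would force [lam j = 0], which is itself a relation. *)
have m0 (m : mpoly.multinom n) : weight m = lam j -> exists i, m i != 0%N.
  move=> wm; apply: contrapT => /forallNP H.
  have m0 i : m i = 0%N by have /negP := H i; rewrite negbK => /eqP.
  have : lam j = 0 by rewrite -wm /weight big1// => i _; rewrite m0 mulr0n.
  by rewrite -weight_delta => /no_relation/(_ j); rewrite eqxx.
split.
  rewrite E big1// => m /eqP /m0[i mi]; rewrite (bigD1 i)//= expr0n.
  by rewrite (negPf mi) mul0r mulr0.
pose lin (m : mpoly.multinom n) := [exists i, m == mpoly.mnm1 i].
pose Q (m : mpoly.multinom n) := weight m == lam j.
have wU i : weight (mpoly.mnm1 i) = lam i.
  rewrite -[RHS]weight_delta; apply: eq_bigr => k _.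
  by rewrite mpoly.mnm1E eq_sym.
pose A i := \sum_(m <- mpoly.msupp p | Q m && lin m) mpoly.mcoeff m p * (m i)%:R.
have AE i : A i != 0 -> lam i = lam j.
  apply: contra_neqP => /eqP ij.
  rewrite /A big1// => m /andP[/eqP Qm /existsP[k /eqP mk]].
  rewrite mk mpoly.mnm1E; case: eqVneq => [ki|]; last by rewrite mulr0.
  by move: Qm; rewrite mk wU ki => /eqP; rewrite (negPf ij).
exists A; split=> // y.
set low := fun i => _.
have S1 z : \sum_(m <- mpoly.msupp p | Q m && lin m)
    mpoly.mcoeff m p * \prod_i z i ^+ m i = \sum_i A i * z i.
  rewrite /A; under [RHS]eq_bigr do rewrite mulr_suml.
  rewrite exchange_big/=; apply: eq_bigr => m /andP[_ /existsP[k /eqP ->]].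
  under [RHS]eq_bigr do rewrite -mulrA.
  rewrite -mulr_sumr; congr (_ * _).
  rewrite (bigD1 k)//= mpoly.mnm1E eqxx big1 => [|i ik]; last first.
    by rewrite mpoly.mnm1E eq_sym (negPf ik).
  rewrite (bigD1 k)//= mpoly.mnm1E eqxx big1 => [|i ik]; last first.
    by rewrite mpoly.mnm1E eq_sym (negPf ik) mul0r.
  by rewrite mulr1 addr0 mul1r.
have EQ z : mpoly.meval z p = \sum_i A i * z i +
    \sum_(m <- mpoly.msupp p | Q m && ~~ lin m)
      mpoly.mcoeff m p * \prod_i z i ^+ m i.
  by rewrite E (bigID lin)/= -S1.
rewrite !EQ.
(* At [low] the linear part vanishes, its variables having the same rank as [lam j]. *)
rewrite [X in _ + (X + _)]big1 ?add0r => [|i _]; last first.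
  have [->|/AE ij] := eqVneq (A i) 0; first by rewrite mul0r.
  by rewrite /low ij ltnn mulr0.
congr (_ + _); apply: eq_bigr => m /andP[/eqP Qm /existsPn nlin].
congr (_ * _); apply: eq_bigr => i _.
have [->|mi] := eqVneq (m i) 0%N; first by rewrite !expr0.
rewrite /low rank_lt//.
(* One factor [y_i] is removed from the monomial. What is left is not constant, since [m] is not
   linear, and witnesses that [lam i] precedes [lam j]. *)
pose m' (k : 'I_n) := (m k - (k == i))%N.
have m'E k : m k = ((k == i) + m' k)%N.
  rewrite /m' subnKC//; case: eqVneq => [->|//].
  by rewrite lt0n.
exists m'; split.
  apply: contrapT => /forallNP H; have /negP := nlin i; apply; apply/eqP.
  apply/mpoly.mnmP => k; rewrite mpoly.mnm1E m'E eq_sym.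
  by have /negP := H k; rewrite negbK => /eqP ->; rewrite addn0.
rewrite -Qm -[X in X + _]weight_delta -weightD; apply: eq_bigr => k _.
by rewrite {1}m'E.
Qed.

(** Collects [graded_eval] over all coordinates. The matrix [A] commutes with the projections
    because its nonzero entries link equal eigenvalues. *)
Lemma graded_map (q : 'I_n -> mpoly.mpoly n R[i]) :
  let g (y : 'cV[R[i]]_n) : 'cV[R[i]]_n :=
    \col_j mpoly.meval (fun i => y i 0) (q j) in
  (forall t (y : 'cV[R[i]]_n), g (diag_mx (\row_i cexp (t%:C * lam i)) *m y) =
     diag_mx (\row_i cexp (t%:C * lam i)) *m g y) ->
  g 0 = 0 /\
  exists A : 'M[R[i]]_n, (forall k, A *m rank_proj k = rank_proj k *m A) /\
    forall (k : 'I_n.+1) (y : 'cV[R[i]]_n),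
      rank_proj k *m g y = A *m (rank_proj k *m y) +
      rank_proj k *m g (\sum_(l < n.+1 | (l < k)%N) rank_proj l *m y).
Proof.
move=> g gT.
have gE (y : 'cV[R[i]]_n) j : g y j 0 = mpoly.meval (fun i => y i 0) (q j).
  by rewrite mxE.
have qT j t y : mpoly.meval (fun i => cexp (t%:C * lam i) * y i) (q j) =
     cexp (t%:C * lam j) * mpoly.meval y (q j).
  transitivity (g (diag_mx (\row_i cexp (t%:C * lam i)) *m \col_i y i) j 0).
    by rewrite gE; apply: mpoly.meval_eq => i; rewrite mul_diag_mx !mxE.
  rewrite gT mul_diag_mx mxE [X in X * _]mxE gE; congr (_ * _).
  by apply: mpoly.meval_eq => i; rewrite mxE.
split.
  apply/colP => j; rewrite gE [RHS]mxE -[RHS](graded_eval (qT j)).1.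
  by apply: mpoly.meval_eq => i; rewrite mxE.
have /choice[A' A'E] := fun j => (graded_eval (qT j)).2.
exists (\matrix_(j, i) A' j i).
have AD k : \matrix_(j, i) A' j i *m rank_proj k =
    rank_proj k *m \matrix_(j, i) A' j i.
  apply/matrixP => j i; rewrite mul_mx_diag mul_diag_mx !mxE.
  have [->|/(A'E j).1 ->] := eqVneq (A' j i) 0; first by rewrite mul0r mulr0.
  by rewrite mulrC.
split=> // k y; apply/colP => j.
rewrite [RHS]mxE mulmxA AD -mulmxA !rank_projE.
have [jk|] := eqVneq (rank (lam j)) k; last by rewrite !mul0r addr0.
rewrite !mul1r !gE (A'E j).2; congr (_ + _).
  by rewrite mxE; apply: eq_bigr => i _; rewrite mxE.
by apply: mpoly.meval_eq => i; rewrite rank_proj_low jk.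
Qed.

End Resonance.

(** * The grading of a symmetric field *)

(** A complete family of orthogonal idempotents, one for each possible rank from 0 to [n]; some may
    be zero. *)
Definition is_grading (K : numFieldType) (n : nat) (E : 'I_n.+1 -> 'M[K]_n) :=
  \sum_k E k = 1%:M /\ forall k l, E k *m E l = if k == l then E k else 0.

(** The triangular form in terms of projections: [M] carries all diagonal blocks at once. For
    [k = 0] the last sum is empty, and [f 0 = 0] makes that equation linear. *)
Definition graded_field (K : numFieldType) (n : nat) (f : 'cV[K]_n -> 'cV[K]_n)
    (E : 'I_n.+1 -> 'M[K]_n) (M : 'M[K]_n) :=
  [/\ f 0 = 0, forall k, E k *m M = M *m E k &
      forall k x, E k *m f x =
        M *m (E k *m x) + E k *m f (\sum_(l < n.+1 | (l < k)%N) E l *m x)].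

(** * Descent from C to K *)

Section BaseFieldDescent.
Variables (R : realType) (F : base_field).
Local Notation K := (field_of R F).
Local Notation C := (field_of R Complexes).
Local Notation iota := (@to_complex R F).

(** In both cases the fixed elements are exactly the image of K, so the descent is argued only
    once. *)
Definition base_conj : {rmorphism R[i] -> R[i]} :=
  match F with Reals => @conjc R | Complexes => idfun end.

Lemma base_conjK : involutive base_conj.
Proof. by rewrite /base_conj; case: F => //; exact: conjcK. Qed.

Lemma base_conj_id (k : K) : base_conj (iota k) = iota k.
Proof. by rewrite /base_conj; case: F k => //= k; rewrite oppr0. Qed.

Lemma base_conj_fixed z : base_conj z = z -> exists k : K, iota k = z.
Proof.
rewrite /base_conj; case: F => /= [|_]; last by exists z.
case: z => a b [] /eqP; rewrite eq_sym -subr_eq0 opprK -mulr2n mulrn_eq0 /=.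
by move=> /eqP ->; exists a.
Qed.

Lemma base_conj_fixed_mx m n (A : 'M[R[i]]_(m, n)) :
  map_mx base_conj A = A -> exists A' : 'M[K]_(m, n), map_mx iota A' = A.
Proof.
move=> AE; have H (p : 'I_m * 'I_n) : exists k : K, iota k = A p.1 p.2.
  by apply: base_conj_fixed; rewrite -[in RHS]AE mxE.
have [g gE] := choice H; exists (\matrix_(i, j) g (i, j)).
by apply/matrixP => i j; rewrite !mxE gE.
Qed.

Lemma complexify_poly n (p : mpoly.mpoly n K) :
  exists q : mpoly.mpoly n C, forall v,
    mpoly.meval (fun i => iota (v i)) q = iota (mpoly.meval v p).
Proof.
exists (\sum_(m <- mpoly.msupp p) iota (mpoly.mcoeff m p) *: mpoly.mpolyX C m) => v.
rewrite raddf_sum/= mpoly.mevalE rmorph_sum/=; apply: eq_bigr => m _.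
rewrite mpoly.mevalZ mpoly.mevalX rmorphM rmorph_prod/=; congr (_ * _).
by apply: eq_bigr => i _; rewrite rmorphXn.
Qed.

End BaseFieldDescent.

(** * Passage to and from eigencoordinates *)

Section Conjugation.
Variables (C : comUnitRingType) (n : nat) (P : 'M[C]_n).
Hypothesis Pu : P \in unitmx.

Definition conjugate (N : 'M[C]_n) := invmx P *m N *m P.

Lemma conjugateM N N' : conjugate N *m conjugate N' = conjugate (N *m N').
Proof. by rewrite /conjugate !mulmxA mulmxK. Qed.

Lemma conjugate_sum (I : Type) (r : seq I) (N : I -> 'M[C]_n) :
  \sum_(i <- r) conjugate (N i) = conjugate (\sum_(i <- r) N i).
Proof. by rewrite /conjugate mulmx_sumr mulmx_suml. Qed.

Lemma conjugate1 : conjugate 1%:M = 1%:M.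
Proof. by rewrite /conjugate mulmx1 mulVmx. Qed.

Lemma conjugate0 : conjugate 0 = 0.
Proof. by rewrite /conjugate mulmx0 mul0mx. Qed.

Lemma mulmx_conjugate N (x : 'cV[C]_n) : P *m (conjugate N *m x) = N *m (P *m x).
Proof. by rewrite /conjugate !mulmxA mulmxV// mul1mx. Qed.

Lemma conjugate_graded (m : nat) (N : 'I_m -> 'M[C]_n) (A : 'M[C]_n)
    (g : 'cV[C]_n -> 'cV[C]_n) (k : 'I_m) :
  let h y := P *m g (invmx P *m y) in
  (forall y, N k *m h y = A *m (N k *m y) +
     N k *m h (\sum_(l < m | (l < k)%N) N l *m y)) ->
  forall x, conjugate (N k) *m g x = conjugate A *m (conjugate (N k) *m x) +
     conjugate (N k) *m g (\sum_(l < m | (l < k)%N) conjugate (N l) *m x).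
Proof.
move=> h hN x; apply: (can_inj (mulKmx Pu)).
have gE z : P *m g z = h (P *m z) by rewrite /h mulKmx.
rewrite mulmxDr !mulmx_conjugate !gE hN mulmx_sumr.
by congr (_ + _ *m h _); apply: eq_bigr => l _; rewrite mulmx_conjugate.
Qed.

End Conjugation.

(** * The grading obtained from a diagonalized one-parameter group *)

Section DiagonalizedToral.
Variables (R : realType) (F : base_field) (n : nat).
Local Notation K := (field_of R F).
Local Notation C := (field_of R Complexes).
Local Notation iota := (@to_complex R F).
Variables (G : set 'M[K]_n) (f : 'cV[K]_n -> 'cV[K]_n).
Variables (B : 'M[K]_n) (P : 'M[C]_n) (lam : 'I_n -> R[i]).
Hypothesis Pu : P \in unitmx.
Hypothesis PB : P *m map_mx iota B = diag_mx (\row_i lam i) *m P.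
Let S := [set expm (of_real F t *: B) | t in [set: R]].
Hypothesis dense : zariski_dense_in S G.
Hypothesis GL : is_subgroup_GL G.
Hypothesis trivial : invariant_algebra G = [set cst c | c in [set: K]].
Hypothesis fG : symmetric_fields G f.

Local Notation T t := (map_mx iota (expm (of_real F t *: B))).

Lemma flow_diag t : P *m T t = diag_mx (\row_i cexp (t%:C * lam i)) *m P.
Proof.
rewrite (expm_diag _ Pu PB); congr (diag_mx _ *m _).
by apply/rowP => i; rewrite !mxE.
Qed.

(* A resonance [m] would make the product of the [(P x)_i ^+ m i] a
   nonconstant invariant. *)
Lemma no_resonance m : weight lam m = 0 -> forall i, m i = 0%N.
Proof.
move=> wm i; apply/eqP/negPn/negP => mi.
pose mono : mpoly.mpoly n C := \prod_i mpoly.mpolyX C (mpoly.mnm1 i) ^+ m i.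
have [p pE] := meval_linear_subst mono (fun i j => P i j).
have pE' v : mpoly.meval v p = \prod_i (\sum_j P i j * v j) ^+ m i.
  rewrite pE /mono rmorph_prod/=; apply: eq_bigr => k _.
  by rewrite rmorphXn /= mpoly.mevalXU.
have inv A : S A -> forall x : 'cV[K]_n,
    mpoly.meval (fun i => iota ((A *m x) i 0)) p =
    mpoly.meval (fun i => iota (x i 0)) p.
  move=> [t _ <-] x; rewrite !pE'.
  have E k : \sum_j P k j * iota ((expm (of_real F t *: B) *m x) j 0) =
      cexp (t%:C * lam k) * \sum_j P k j * iota (x j 0).
    have := congr1 (fun M : 'M[C]_n => (M *m map_mx iota x) k 0) (flow_diag t).
    rewrite -!mulmxA mul_diag_mx -map_mxM !mxE.
    move=> E; apply: eq_trans (etrans E _); last congr (_ * _);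
      by apply: eq_bigr => j _; rewrite !mxE.
  under eq_bigr do rewrite E exprMn.
  by rewrite big_split/= cexp_weight wm mulr0 cexp0 mul1r.
(* The invariant takes the value 1 where all eigencoordinates are 1, and the value 0 at the origin
   since [m i] is positive. *)
have := complex_invariant_const dense GL trivial inv
  (fun j => (invmx P *m const_mx 1 : 'cV[C]_n) j 0) (fun=> 0).
rewrite !pE' (_ : \prod_i _ = 1); last first.
  apply: big1 => k _.
  have := congr1 (fun M : 'cV[C]_n => M k 0) (mulKVmx Pu (const_mx 1 : 'cV[C]_n)).
  by rewrite !mxE => ->; rewrite expr1n.
rewrite (bigD1 i)//= big1 => [|j _]; last by rewrite mulr0.
by rewrite expr0n (negPf mi) mul0r => /eqP; rewrite oner_eq0.
Qed.

Local Notation EC k := (conjugate P (rank_proj lam k)).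

(** An eigenrow for [mu] is a combination of those rows of [P] whose eigenvalue is [mu], and [EC k]
    keeps or kills all of them together. *)
Lemma eigenrow (v : 'rV[C]_n) mu k : v *m map_mx iota B = mu *: v ->
  v *m EC k = (rank lam mu == k)%:R *: v /\
  (v != 0 -> exists j, mu = lam j).
Proof.
move=> vB; have [a vE] : exists a, v = a *m P.
  by exists (v *m invmx P); rewrite mulmxKV.
have aE j : a 0 j * lam j = mu * a 0 j.
  have : a *m diag_mx (\row_i lam i) = mu *: a.
    apply: (can_inj (mulmxK Pu)).
    by rewrite -mulmxA -PB mulmxA -vE vB vE scalemxAl.
  by move=> /matrixP/(_ 0 j); rewrite mul_mx_diag !mxE.
have aj j : a 0 j != 0 -> mu = lam j.
  by move=> a0; apply: (mulIf a0); rewrite -aE mulrC.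
split.
  rewrite {1}vE /conjugate !mulmxA mulmxK// vE scalemxAl; congr (_ *m _).
  apply/rowP => j; rewrite mul_mx_diag !mxE.
  have [->|/aj ->] := eqVneq (a 0 j) 0; first by rewrite mul0r mulr0.
  by rewrite mulrC.
move=> v0; apply: contrapT => /forallNP H; move/eqP: v0; apply.
rewrite vE (_ : a = 0) ?mul0mx//; apply/rowP => j; rewrite [RHS]mxE.
by apply/eqP/negPn/negP => /aj/H.
Qed.

(* Conjugation maps the eigenrows [P] of [B] to eigenrows for conjugate
   eigenvalues, which have the same rank. *)
Lemma projection_descends k : exists E : 'M[K]_n, map_mx iota E = EC k.
Proof.
apply: base_conj_fixed_mx; set c := base_conj R F.
pose Pc := map_mx c P.
have Pcu : Pc \in unitmx by rewrite map_unitmx.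
have cB : map_mx c (map_mx iota B) = map_mx iota B.
  by apply/matrixP => i j; rewrite !mxE base_conj_id.
have rowB i : row i Pc *m map_mx iota B = c (lam i) *: row i Pc.
  rewrite -cB -row_mul -map_mxM PB map_mxM map_diag_mx.
  by apply/rowP => j; rewrite mxE mul_diag_mx !mxE.
have row0 i : row i Pc != 0.
  apply/eqP => r0; have := congr1 (row i) (mulmxV Pcu).
  rewrite row_mul r0 mul0mx => /rowP/(_ i); rewrite !mxE eqxx => /eqP.
  by rewrite eq_sym oner_eq0.
have clam i : exists j, c (lam i) = lam j by apply: (eigenrow 0 (rowB i)).2.
(* [EC k] acts on the conjugate eigenrows by the same diagonal matrix as on [P], so it equals its
   own conjugate. *)
have PcE : Pc *m EC k = rank_proj lam k *m Pc.
  apply/row_matrixP => i; rewrite row_mul (eigenrow k (rowB i)).1.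
  rewrite (rank_fixed _ (@base_conjK R F) clam).
  by apply/rowP => j; rewrite [RHS]mxE mul_diag_mx !mxE.
apply: (can_inj (mulKmx Pcu)); rewrite PcE /conjugate !map_mxM map_invmx.
rewrite -[invmx _ *m _ *m _]mulmxA (mulKVmx Pcu); congr (mulmx _ _).
by apply/matrixP => i j; rewrite !mxE rmorphMn /= rmorph_nat.
Qed.

(** Equivariance under the flow is a polynomial identity on K^n, which persists on C^n by
    [meval_eq0_complex]. *)
Lemma field_complexification : exists2 fC : 'cV[C]_n -> 'cV[C]_n,
  polynomial_map fC &
  (forall x, fC (map_mx iota x) = map_mx iota (f x)) /\
  forall t z, fC (T t *m z) = T t *m fC z.
Proof.
have [pf fT] := fG.
have /choice[p pE] : forall i, exists p : mpoly.mpoly n K,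
  forall x, f x i 0 = mpoly.meval (fun i => x i 0) p := pf.
have [q qE] := choice (fun i => complexify_poly (p i)).
pose fC (y : 'cV[C]_n) : 'cV[C]_n := \col_i mpoly.meval (fun j => y j 0) (q i).
have fCi x : fC (map_mx iota x) = map_mx iota (f x).
  apply/colP => i; rewrite !mxE pE -qE; apply: mpoly.meval_eq => j.
  by rewrite mxE.
exists fC; first by move=> i; exists (q i) => x; rewrite mxE.
split=> // t z; apply/colP => i.
have [p1 p1E] := meval_linear_subst (q i) (fun j k => T t j k).
pose r : mpoly.mpoly n C := p1 - \sum_k T t i k *: q k.
have rE (v : 'cV[C]_n) : mpoly.meval (fun j => v j 0) r =
    fC (T t *m v) i 0 - (T t *m fC v) i 0.
  rewrite mpoly.mevalB p1E mxE; congr (_ - _).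
    by apply: mpoly.meval_eq => j; rewrite mxE.
  rewrite raddf_sum mxE/=; apply: eq_bigr => k _.
  by rewrite mpoly.mevalZ [fC v k 0]mxE.
apply/eqP; rewrite -subr_eq0 -rE; apply/eqP.
apply: (@meval_eq0_complex R F) => x.
have -> : mpoly.meval (fun i => iota (x i 0)) r =
    mpoly.meval (fun i => (map_mx iota x) i 0) r.
  by apply: mpoly.meval_eq => j; rewrite mxE.
rewrite rE -map_mxM !fCi -map_mxM fT ?subrr//.
by apply: dense.1; exists t.
Qed.

(** In eigencoordinates the flow is diagonal, so [graded_map] applies; the result is conjugated back
    by [P]. *)
Lemma complexification_graded : exists2 fC : 'cV[C]_n -> 'cV[C]_n,
  (forall x, fC (map_mx iota x) = map_mx iota (f x)) &
  fC 0 = 0 /\ exists MC : 'M[C]_n, (forall k, EC k *m MC = MC *m EC k) /\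
    forall (k : 'I_n.+1) x, EC k *m fC x = MC *m (EC k *m x) +
      EC k *m fC (\sum_(l < n.+1 | (l < k)%N) EC l *m x).
Proof.
have [fC pfC [fCi fCT]] := field_complexification.
exists fC => //.
pose Fd (y : 'cV[C]_n) := P *m fC (invmx P *m y).
have /choice[q qE] : forall j, exists q : mpoly.mpoly n C, forall y,
    Fd y j 0 = mpoly.meval (fun i => y i 0) q.
  move=> j; have /choice[p pE] := pfC.
  have [p' p'E] := choice
    (fun i => meval_linear_subst (p i) (fun k l => invmx P k l)).
  exists (\sum_i P j i *: p' i) => y.
  rewrite mxE raddf_sum/=; apply: eq_bigr => i _.
  rewrite mpoly.mevalZ p'E pE; congr (_ * _).
  by apply: mpoly.meval_eq => k; rewrite mxE.
have gE (y : 'cV[C]_n) : \col_j mpoly.meval (fun i => y i 0) (q j) = Fd y.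
  by apply/colP => j; rewrite mxE qE.
have [|F0 [A [AD DF]]] := @graded_map _ _ lam no_resonance q.
  move=> t y; rewrite !gE /Fd [in LHS]mulmxA.
  have -> : invmx P *m diag_mx (\row_i cexp (t%:C * lam i)) = T t *m invmx P.
    apply: (can_inj (mulKmx Pu)); rewrite (mulKVmx Pu) mulmxA flow_diag.
    by rewrite (mulmxK Pu).
  by rewrite -mulmxA fCT mulmxA flow_diag -mulmxA.
split.
  apply: (can_inj (mulKmx Pu)); rewrite mulmx0 -[RHS]F0 gE.
  by rewrite /Fd mulmx0.
exists (conjugate P A); split=> k.
  by rewrite !(conjugateM Pu) AD.
by apply: (conjugate_graded Pu) => y; have := DF k y; rewrite !gE.
Qed.

Lemma grading_exists : exists E M, is_grading E /\ graded_field f E M.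
Proof.
have [fC fCi [fC0 [MC [ECM ECF]]]] := complexification_graded.
have EC1 : \sum_(k < n.+1) EC k = 1%:M.
  by rewrite conjugate_sum rank_proj_sum (conjugate1 Pu).
have ECE (k l : 'I_n.+1) : EC k *m EC l = if k == l then EC k else 0.
  by rewrite (conjugateM Pu) rank_projM; case: eqP => // _; exact: conjugate0.
have /choice[E EE] := fun k : 'I_n.+1 => projection_descends k.
(* On block [k] the linear part is [E k f E k]. Writing it through [f] shows that [MC] has entries
   in K. *)
pose M : 'M[K]_n := \matrix_(i, j) (\sum_k E k *m f (E k *m delta_mx j 0)) i 0.
have MM : map_mx iota M = MC.
  (* A vector of block [k] has no lower components, and [fC 0 = 0], so only the linear term is
     left. *)
  have ECk (k : 'I_n.+1) x : MC *m (EC k *m x) = EC k *m fC (EC k *m x).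
    rewrite ECF big1 => [|l lk]; last first.
      rewrite mulmxA ECE; case: eqVneq lk => [->|_ _]; first by rewrite ltnn.
      by rewrite mul0mx.
    by rewrite fC0 mulmx0 addr0 mulmxA ECE eqxx.
  apply/matrixP => i j.
  have -> : MC i j = (MC *m map_mx iota (delta_mx j 0 : 'cV[K]_n)) i 0.
    rewrite mxE (bigD1 j)//= !mxE !eqxx rmorph1 mulr1 big1 ?addr0// => k kj.
    by rewrite !mxE (negPf kj) rmorph0 mulr0.
  rewrite -[map_mx iota (delta_mx _ _)]mul1mx -EC1 mulmx_suml mulmx_sumr 2!mxE.
  have -> : \sum_(k < n.+1) MC *m (EC k *m map_mx iota (delta_mx j 0)) =
      map_mx iota (\sum_k E k *m f (E k *m delta_mx j 0)).
    rewrite map_mx_sum; apply: eq_bigr => k _.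
    by rewrite ECk -EE -map_mxM fCi map_mxM.
  by rewrite mxE.
exists E, M; split; [split|split].
- apply: (@map_mx_inj _ _ iota); rewrite map_mx_sum map_mx1 -EC1.
  by apply: eq_bigr => k _; rewrite EE.
- move=> k l; apply: (@map_mx_inj _ _ iota); rewrite map_mxM !EE ECE.
  by case: eqP => _; rewrite ?EE ?map_mx0.
- by apply: (@map_mx_inj _ _ iota); rewrite -fCi map_mx0 fC0.
- by move=> k; apply: (@map_mx_inj _ _ iota); rewrite !map_mxM EE MM ECM.
move=> k x; apply: (@map_mx_inj _ _ iota).
rewrite map_mxD !map_mxM -!fCi map_mx_sum EE MM ECF; congr (_ + _ *m fC _).
by apply: eq_bigr => l _; rewrite map_mxM EE.
Qed.

End DiagonalizedToral.

(** * Triangular form and solutions *)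

Section TriangularForm.
Variables (K : numFieldType) (n : nat) (f : 'cV[K]_n -> 'cV[K]_n).
Variables (E : 'I_n.+1 -> 'M[K]_n) (M : 'M[K]_n).
Hypothesis pf : polynomial_map f.
Hypothesis gE : is_grading E.
Hypothesis gf : graded_field f E M.

Definition grading_space k : {vspace 'cV[K]_n} :=
  limg (linfun (mulmx (E k) : 'cV[K]_n -> 'cV[K]_n)).

Lemma grading_spaceP k x : reflect (E k *m x = x) (x \in grading_space k).
Proof.
apply: (iffP idP) => [/memv_imgP[y _ ->]|<-].
  by rewrite lfunE /= mulmxA gE.2 eqxx.
apply/memv_imgP; exists x; first exact: memvf.
by rewrite lfunE.
Qed.

Lemma grading_direct : direct_decomposition grading_space.
Proof.
have mem k x : E k *m x \in grading_space k.
  by apply/grading_spaceP; rewrite mulmxA gE.2 eqxx.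
split.
  apply/eqP; rewrite eqEsubv subvf /=; apply/subvP => x _.
  rewrite -[x]mul1mx -gE.1 mulmx_suml; apply: memv_sumr => k _.
  exact: mem.
apply/directv_sum_independent => u uW u0 k _.
have := congr1 (mulmx (E k)) u0; rewrite mulmx0 mulmx_sumr => <-.
have uE l : E l *m u l = u l by apply/grading_spaceP/uW.
rewrite (bigD1 k)//= uE big1 ?addr0// => l lk.
by rewrite -uE mulmxA gE.2 eq_sym (negPf lk) mul0mx.
Qed.

Lemma component_grading k x : component grading_space k x = E k *m x.
Proof.
have xW : x \in (\sum_(i < n.+1) grading_space i)%VS.
  by rewrite grading_direct.1 memvf.
have cE l : E l *m component grading_space l x = component grading_space l x.
  by apply/grading_spaceP; exact: memv_sum_pi.
rewrite -[in RHS](sumv_pi_sum erefl xW) mulmx_sumr (bigD1 k)//= cE.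
rewrite big1 ?addr0// => l lk.
by rewrite -[X in _ *m X]cE mulmxA gE.2 eq_sym (negPf lk) mul0mx.
Qed.

Lemma polynomial_mapMl m (N : 'M[K]_(m, n)) : polynomial_map (fun x => N *m f x).
Proof.
move=> i; have [p pE] := choice pf.
exists (\sum_j N i j *: p j) => x.
rewrite mxE raddf_sum/=; apply: eq_bigr => j _.
by rewrite mpoly.mevalZ pE.
Qed.

(** [M] commutes with [E k], hence restricts to each block; [q_k] is [E k f] evaluated at the lower
    components. *)
Lemma grading_triangular : triangular_form grading_space f.
Proof.
have [f0 EM fE] := gf.
exists (fun k => linfun (vsproj (grading_space k) \o mulmx M \o vsval)).
(* Block 0 has no lower components and [f 0 = 0], so zero is the right choice there. *)
exists (fun k => if k == ord0 then cst 0 else fun x => E k *m f x); split.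
- move=> k; case: ifP => _; last exact: polynomial_mapMl.
  by move=> i; exists 0 => x; rewrite mpoly.meval0 mxE.
- by move=> k k0; case: eqP => // /eqP; rewrite -val_eqE /= k0.
move=> k x; rewrite lfunE /= !component_grading.
have mem y : E k *m y \in grading_space k.
  by apply/grading_spaceP; rewrite mulmxA gE.2 eqxx.
rewrite [X in M *m vsval X](_ : _ = vsproj (grading_space k) (E k *m x))//.
rewrite !vsprojK ?mem//; last by rewrite mulmxA -EM -mulmxA mem.
rewrite fE; congr (_ + _); under [in RHS]eq_bigr do rewrite component_grading.
by case: eqP => [->|//]; rewrite big1// f0 mulmx0.
Qed.

End TriangularForm.

(** * Solving the graded system *)

Section Solutions.
Variables (R : realType) (F : base_field) (n : nat).
Local Notation K := (field_of R F).
Local Notation iota := (@to_complex R F).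

Lemma polynomial_exp_poly_on (D : set R) (phi : 'cV[K]_n -> K) (y : R -> 'cV[K]_n) :
  polynomial_fun phi ->
  (forall i, exp_poly_on D (fun t => iota (y t i 0))) ->
  exp_poly_on D (fun t => iota (phi (y t))).
Proof.
move=> [p pE] ey.
rewrite (_ : (fun t => _) = fun t => \sum_(m <- mpoly.msupp p)
    iota (mpoly.mcoeff m p) * \prod_i iota (y t i 0) ^+ m i); last first.
  apply/funext => t; rewrite pE mpoly.mevalE rmorph_sum; apply: eq_bigr => m _.
  rewrite rmorphM rmorph_prod; congr (_ * _).
  by apply: eq_bigr => i _; rewrite rmorphXn.
apply: exp_poly_on_sum => m _; apply: exp_poly_onM; first exact: exp_poly_on_cst.
by apply: exp_poly_on_prod => i; exact: exp_poly_onX.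
Qed.

(** Strong induction on the block: once the lower components are exponential polynomials on [D], so
    is the forcing [b], and [E k *m x] solves a linear system with matrix [M]. *)
Lemma graded_solution_elementary (f : 'cV[K]_n -> 'cV[K]_n)
    (E : 'I_n.+1 -> 'M[K]_n) (M : 'M[K]_n) (D : set R) (x : R -> 'cV[K]_n) :
  polynomial_map f -> is_grading E -> graded_field f E M ->
  is_interval D -> is_solution f D x -> elementary_vector D x.
Proof.
move=> pf [E1 _] [_ _ fE] iD sol.
have iotaM m (N : 'M[K]_(m, n)) (y : 'cV[K]_n) i :
    iota ((N *m y) i 0) = \sum_j iota (N i j) * iota (y j 0).
  by rewrite mxE rmorph_sum; apply: eq_bigr => j _; rewrite rmorphM.
have block (k : 'I_n.+1) i : exp_poly_on D (fun t => iota ((E k *m x t) i 0)).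
  have [m km] := ubnP (k : nat); elim: m k km i => // m IH k; rewrite ltnS => km i.
  pose b t := E k *m f (\sum_(l < n.+1 | (l < k)%N) E l *m x t).
  have eb j : exp_poly_on D (fun t => (map_mx iota (b t)) j 0).
    under eq_fun do rewrite mxE.
    apply: (polynomial_exp_poly_on (polynomial_mapMl pf (E k) j)
      (y := fun t => \sum_(l < n.+1 | (l < k)%N) E l *m x t)) => j'.
    under eq_fun do rewrite summxE rmorph_sum.
    by apply: exp_poly_on_sum => l lk; apply: IH; exact: leq_trans lk km.
  have iE y j : (map_mx iota (y : 'cV[K]_n)) j 0 = iota (y j 0) by rewrite mxE.
  suff H : exp_poly_on D (fun t => (map_mx iota (E k *m x t)) i 0).
    by apply: (exp_poly_on_eq H) => t _; rewrite iE.
  apply: (linear_ode (A := map_mx iota M)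
    (x := fun t => map_mx iota (E k *m x t)) iD eb) => t j Dt.
  under eq_fun do rewrite iE iotaM.
  apply: cderiv_eq.
    by apply: cderiv_sum => l _; exact: cderivZ (cderiv_solution l sol Dt).
  by rewrite -map_mxM !iE -iotaM fE mxE rmorphD.
move=> i; apply: exp_poly_on_elementary.
apply: exp_poly_on_eq (exp_poly_on_sum (index_enum 'I_n.+1) (P := xpredT)
  (fun k _ => block k i)) _ => t Dt.
by rewrite -[x t in LHS]mul1mx -E1 mulmx_suml summxE rmorph_sum.
Qed.

End Solutions.

Theorem proposition4p2p11 (R : realType) (F : base_field) (n : nat)
    (G : set 'M[field_of R F]_n)
    (f : 'cV[field_of R F]_n -> 'cV[field_of R F]_n) :
  toral G ->
  invariant_algebra G = [set cst c | c in [set: field_of R F]] ->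
  symmetric_fields G f ->
  (exists (r : nat) (W : 'I_r -> {vspace 'cV[field_of R F]_n}),
     [/\ (1 <= r)%N, direct_decomposition W & triangular_form W f]) /\
  (forall (D : set R) (x : R -> 'cV[field_of R F]_n),
     open D -> is_interval D -> is_solution f D x -> elementary_vector D x).
Proof.
move=> [[GL _] _ [B [P Pu /diagonalizable_forPex[d PB]] dense]] trivial fG.
have {}PB : P *m map_mx (@to_complex R F) B = diag_mx (\row_i d 0 i) *m P.
  rewrite (_ : \row_i _ = d); first exact/(simmxP Pu).
  by apply/rowP => i; rewrite mxE.
have [E [M [gE gf]]] := grading_exists Pu PB dense GL trivial fG.
split; last by move=> D x _; exact: graded_solution_elementary fG.1 gE gf.
(* One block for each possible rank; blocks may be the zero space, and [n.+1] is positive even if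
   [n] is 0. *)
exists n.+1, (grading_space E); split=> //.
  exact: grading_direct.
exact: grading_triangular fG.1 gE gf.
Qed.
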